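(* Let $A$ be a positive self-adjoint operator on $L^2(X,\mu)$, where $(X,\mu)$ is a measure space. For $\lambda>0$ let $\Pi_\lambda=\chi_A(]0,\lambda])$ be the spectral projection of $A$ on $]0,\lambda]$, and suppose that $F(\lambda)=\|\Pi_\lambda\|_{1,\infty}<+\infty$ for all $\lambda>0$. Suppose moreover that the Stieltjes integral $$G(\lambda)=\int_0^\lambda \frac{dF(u)}{u}$$ converges. Then any non-zero $f\in L^2(X)\cap(\ker A)^\perp$ of finite energy $\mathcal{E}(f)=\langle Af,f\rangle_2$ satisfies $$\int_X H\Bigl(\frac{|f(x)|^2}{4\,\mathcal{E}(f)}\Bigr)\,d\mu(x)\le 1,$$ where $H(y)=y\,G^{-1}(y)$.
   Context: ''Positive'' means $\langle Af,f\rangle\ge 0$; $A$ may be unbounded and may have a kernel. The energy is $\mathcal{E}(f)=\|A^{1/2}f\|_2^2$, finite exactly when $f$ is in the domain of $A^{1/2}$. For a bounded operator $P$ on $L^2(X)$, $\|P\|_{1,\infty}=\sup\{\|Pf\|_\infty : f\in L^1\cap L^2,\ \|f\|_1\le 1\}\in[0,+\infty]$ is its norm as an operator from $L^1$ to $L^\infty$. The function $F$ is non-decreasing and right continuous on $]0,\infty[$; one sets $F(0)=0$, and the Stieltjes integral takes into account a possible jump of $F$ at $0$ (so convergence of $G$ forces $F(0^+)=0$); equivalently $G(\lambda)=\lambda^{-1}F(\lambda)+\int_0^\lambda u^{-2}F(u)\,du$. $G^{-1}$ denotes the right continuous inverse $G^{-1}(y)=\sup\{\lambda\ge 0 : G(\lambda)\le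 y\}\in[0,+\infty]$ (with $G(0)=0$, and $0\cdot\infty=0$ in the definition of $H$). *)

(* Defs.v *)
From HB Require Import structures.
From mathcomp Require Import all_boot all_order all_algebra.
From mathcomp Require Import complex.
From mathcomp Require Import all_classical all_reals all_analysis.

Set Implicit Arguments.
Unset Strict Implicit.
Unset Printing Implicit Defensive.

Import Order.TTheory GRing.Theory Num.Theory.
Import numFieldNormedType.Exports.

Local Open Scope classical_set_scope.
Local Open Scope ring_scope.

Section complex_Lp.
Context {R : realType} {d : measure_display} {X : measurableType d}.
Variable mu : {measure set X -> \bar R}.
Implicit Types f g : X -> R[i].

Definition cmod (z : R[i]) : R := ComplexField.Normc.normc z.

Definition cnorm (p : \bar R) f : \bar R :=
  Lnorm mu p (fun x => (cmod (f x))%:E).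

(* Elements of the complex space L^p(X, mu) are represented by functions;
   they have to be compared with almost everywhere equality. *)
Definition in_Lp (p : \bar R) : set (X -> R[i]) := [set f |
  [/\ measurable_fun [set: X] (fun x => complex.Re (f x)),
      measurable_fun [set: X] (fun x => complex.Im (f x)) &
      (cnorm p f < +oo)%E]].

Definition eqae f g : Prop := {ae mu, forall x, f x = g x}.

Definition cintegral f : R[i] :=
  Complex (\int[mu]_x complex.Re (f x)) (\int[mu]_x complex.Im (f x)).

Definition inner f g : R[i] := cintegral (fun x => f x * conjc (g x)).

(* For P bounded on L^2: its norm as an operator from L^1 to L^oo. *)
Definition norm_1oo (P : (X -> R[i]) -> (X -> R[i])) : \bar R :=
  ereal_sup [set cnorm +oo%E (P f) | f in
    [set f | [/\ in_Lp 1 f, in_Lp 2 f & (cnorm 1 f <= 1)%E]]].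

Lemma norm_1oo_ge0 P : (0 <= norm_1oo P)%E.
Proof.
apply: (le_trans (Lnorm_ge0 mu +oo%E (fun x => (cmod (P (cst 0) x))%:E))).
apply: ereal_sup_ubound; exists (cst 0) => //=.
have n0 p : p != 0 -> cnorm p%:E (cst 0) = 0%E.
  move=> p0; have -> : cnorm p%:E (cst 0) = Lnorm mu p%:E (cst 0%E).
    by apply: eq_Lnorm => x; rewrite /cmod /= expr0n /= addr0 sqrtr0.
  by rewrite Lnorm0.
have m0 : measurable_fun [set: X] (fun x : X => 0 : R) by exact: measurable_cst.
by split; rewrite ?n0 ?pnatr_eq0 ?oner_eq0// ?lee_fin//; split => //=;
  rewrite n0 ?ltry ?oner_eq0 ?pnatr_eq0.
Qed.

End complex_Lp.

Section operators.
Context {R : realType} {d : measure_display} {X : measurableType d}.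
Variable mu : {measure set X -> \bar R}.

(* Possibly unbounded linear operators on the complex space L^2(X, mu).  The
   domain and the action are compatible with almost everywhere equality; the
   values outside the domain are irrelevant. *)
Record operator := Operator {
  dom : set (X -> R[i]) ;
  op_fun :> (X -> R[i]) -> (X -> R[i]) ;
  dom_L2 : dom `<=` in_Lp mu 2 ;
  dom_eqae : forall f g, dom f -> in_Lp mu 2 g -> eqae mu f g -> dom g ;
  dom_zero : dom (fun=> 0) ;
  dom_lin : forall (c : R[i]) f g, dom f -> dom g ->
    dom (fun x => c * f x + g x) ;
  op_L2 : forall f, dom f -> in_Lp mu 2 (op_fun f) ;
  op_eqae : forall f g, dom f -> dom g -> eqae mu f g ->
    eqae mu (op_fun f) (op_fun g) ;
  op_lin : forall (c : R[i]) f g, dom f -> dom g ->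
    eqae mu (op_fun (fun x => c * f x + g x))
            (fun x => c * op_fun f x + op_fun g x) }.

Implicit Type A : operator.

Definition densely_defined A : Prop :=
  forall f, in_Lp mu 2 f -> forall e : R, 0 < e ->
    exists2 g, dom A g & (cnorm mu 2 (fun x => f x - g x)%R < e%:E)%E.

(* A = A^*: the adjoint has the same domain and the same values. *)
Definition self_adjoint A : Prop :=
  densely_defined A /\
  forall f g, in_Lp mu 2 f -> in_Lp mu 2 g ->
    (dom A f /\ eqae mu (A f) g) <->
    (forall u, dom A u -> inner mu (A u) f = inner mu u g).

(* In the order of R[i], 0 <= z means that z is real and nonnegative. *)
Definition positive_op A : Prop := forall f, dom A f -> 0 <= inner mu (A f) f.

Definition ker A : set (X -> R[i]) :=
  [set f | dom A f /\ eqae mu (A f) (fun=> 0)].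

Definition ortho_compl (S : set (X -> R[i])) : set (X -> R[i]) :=
  [set f | in_Lp mu 2 f /\ forall g, S g -> inner mu f g = 0].

(* Projection-valued measures on the Borel sets of the real line. *)
Record projection_valued_measure (E : set R -> operator) : Prop := {
  pvm_dom : forall B, measurable B -> dom (E B) = in_Lp mu 2 ;
  pvm_idem : forall B f, measurable B -> in_Lp mu 2 f ->
    eqae mu (E B (E B f)) (E B f) ;
  pvm_sym : forall B f g, measurable B -> in_Lp mu 2 f -> in_Lp mu 2 g ->
    inner mu (E B f) g = inner mu f (E B g) ;
  pvm_set0 : forall f, in_Lp mu 2 f -> eqae mu (E set0 f) (fun=> 0) ;
  pvm_setT : forall f, in_Lp mu 2 f -> eqae mu (E setT f) f ;
  pvm_setI : forall B C f, measurable B -> measurable C -> in_Lp mu 2 f ->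
    eqae mu (E (B `&` C) f) (E B (E C f)) ;
  pvm_bigcup : forall (B : nat -> set R) f, (forall k, measurable (B k)) ->
    trivIset setT B -> in_Lp mu 2 f ->
    cnorm mu 2 (fun x => E (\bigcup_k B k) f x - \sum_(k < n) E (B k) f x)%R
      @[n --> \oo] --> 0%E }.

Definition spectral_dist (E : set R -> operator) (f : X -> R[i])
  (B : set R) : \bar R := (complex.Re (inner mu (E B f) f))%:E.

(* T is the integral of the real function phi against E: the domain of T
   consists of the f such that phi is square integrable for the measure
   B |-> <E(B) f, f>, and <T f, f> is the integral of phi for this measure
   (by polarization, these quadratic values determine T). *)
Definition spectral_integral (E : set R -> operator) (phi : R -> R)
    (T : operator) : Prop :=
  (dom T = [set f | in_Lp mu 2 f /\
     (\int[spectral_dist E f]_t ((phi t) ^+ 2)%:E < +oo)%E]) /\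
  forall f, dom T f ->
    inner mu (T f) f =
    Complex (fine (\int[spectral_dist E f]_t (phi t)%:E)%E) 0.

Definition spectral_measure_of A (E : set R -> operator) : Prop :=
  projection_valued_measure E /\ spectral_integral E id A.

(* S is A^{1/2} in the functional calculus of the positive self-adjoint
   operator with spectral measure E; Num.sqrt is 0 on negative numbers, which
   are not charged by E. *)
Definition sqrt_operator (E : set R -> operator) (S : operator) : Prop :=
  spectral_integral E Num.sqrt S.

Definition spectral_density (E : set R -> operator) (l : R) : \bar R :=
  norm_1oo mu (E `]0, l]%classic).

Lemma spectral_density_ge0 E l : (0 <= spectral_density E l)%E.
Proof. exact: norm_1oo_ge0. Qed.

End operators.

Section stieltjes.
Context {R : realType}.
Variables (F : R -> \bar R) (F_ge0 : forall u, (0 <= F u)%E).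

(* Right limits of a nonnegative, nondecreasing and finite function F on
   ]0, +oo[, extended by 0 on the negative reals: this is F itself at the points
   of right continuity, and the jump at 0 is F(0+). *)
Definition right_limit of (forall u, (0 <= F u)%E) := fun l : R =>
  if l < 0 then 0 else inf [set fine (F u) | u in `]l, +oo[].

Let S l := [set fine (F u) | u in `]l, +oo[].

Let S_lb l : lbound (S l) 0.
Proof. by move=> _ [u _ <-]; exact: fine_ge0. Qed.

Let S_inf l : has_inf (S l).
Proof.
split; last by exists 0; exact: S_lb.
by exists (fine (F (l + 1))), (l + 1) => //=; rewrite in_itv/= ltrDl ltr01.
Qed.

Let inf_le l u : l < u -> inf (S l) <= fine (F u).
Proof.
by move=> lu; apply: ge_inf; [case: (S_inf l)|exists u => //=; rewrite in_itv/= lu].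
Qed.

Let right_limit_nd : {homo right_limit F_ge0 : x y / x <= y}.
Proof.
move=> x y xy; rewrite /right_limit; case: (ltP x 0) => x0.
  by case: ifP => // _; apply: lb_le_inf; [case: (S_inf y)|exact: S_lb].
rewrite ltNge (le_trans x0 xy)/=.
apply: lb_le_inf; first by case: (S_inf y).
move=> _ [u /= yu <-]; move: yu; rewrite in_itv/= andbT => yu.
by apply: inf_le; exact: le_lt_trans yu.
Qed.

Let right_limit_rc : right_continuous (right_limit F_ge0).
Proof.
move=> x; apply/(@cvgrPdist_le _ R^o) => e e0.
have [x0|x0] := ltP x 0.
  near=> y; have y0 : y < 0 by near: y; exact: nbhs_right_lt.
  by rewrite /right_limit x0 y0 subrr normr0 ltW.
have [_ [u /= xu <-] uxe] := inf_adherent e0 (S_inf x).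
move: xu; rewrite in_itv/= andbT => xu.
near=> y; have xy : x < y by near: y; exact: nbhs_right_gt.
have yu : y < u by near: y; exact: nbhs_right_lt.
rewrite distrC ger0_norm ?subr_ge0; last exact/right_limit_nd/ltW.
rewrite /right_limit (ltNge x) x0 (ltNge y) (le_trans x0 (ltW xy))/= lerBlDl.
by apply: (le_trans (inf_le yu)); exact: ltW.
Unshelve. all: by end_near. Qed.

HB.instance Definition _ :=
  isCumulative.Build R _ R (right_limit F_ge0) right_limit_nd right_limit_rc.

(* The Stieltjes integral of dF(u)/u over [0, l]; as 0^-1 = +oo in \bar R, it
   is infinite when F jumps at 0. *)
Definition stieltjes_inv (l : R) : \bar R :=
  (\int[lebesgue_stieltjes_measure (right_limit F_ge0)]_(u in `[0%R, l])
     (u%:E)^-1)%E.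

End stieltjes.

(* The right continuous inverse of a nondecreasing function on [0, +oo[. *)
Definition rc_inverse {R : realType} (G : R -> \bar R) (y : R) : \bar R :=
  ereal_sup [set l%:E | l in [set l : R | 0 <= l /\ (G l <= y%:E)%E]].

(* Main.v *)
Require Import Defs.
From HB Require Import structures.
From mathcomp Require Import all_boot all_order all_algebra.
From mathcomp Require Import complex.
From mathcomp Require Import all_classical all_reals all_analysis.
From mathcomp Require Import measurable_realfun ess_sup_inf.
From mathcomp Require Import ring lra.

Set Implicit Arguments.
Unset Strict Implicit.
Unset Printing Implicit Defensive.

Import Order.TTheory GRing.Theory Num.Theory.
Import numFieldNormedType.Exports.

Local Open Scope classical_set_scope.
Local Open Scope ring_scope.

(* Write E(B) for the spectral projections of A, T for its square root and e for
   |T f|^2.  By duality, the bound |E(]0, u]) g|^2 <= F(u) |g|_1^2 and an Abel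
   summation over a geometric subdivision of ]0, l] give
   |<E(]0, l]) f, g>|^2 <= G(l) e |g|_1^2, that is, |E(]0, l]) f|^2 <= G(l) e
   almost everywhere.  Since f = E(]0, l]) f + E(]l, oo[) f, at almost every
   point where G(l) <= |f|^2 / (4 e) one has |f|^2 / 4 <= |E(]l, oo[) f|^2.
   Integrating over X and then over l, the left-hand side gives
   e times the integral of H(|f|^2 / (4 e)), and the right-hand side is at most
   the integral of |E(]l, oo[) f|^2 over l > 0, which is e. *)

(** * The real inner product on complex L^2 *)

(** The weight 1/u in G comes from Cauchy-Schwarz: a spectral piece of <f, g> near the level u is
    split into u^(1/2) on f, whose squares sum to at most the energy, and u^(-1/2) on g, whose
    squares sum to at most about the integral of dF(u)/u. The 4 is the square of the 2 that arises
    when f is cut into two spectral pieces, one of which must carry at least half of |f|. That these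
    two pieces exhaust f rests on E(]-oo, 0]) f = 0: positivity of A excludes the negative part,
    orthogonality to the kernel the atom at 0. The obstacle is that [spectral_integral] fixes only
    the domain of T and the values <T f, f>. Symmetry of T, its compatibility with the projections
    and lower bounds on |T f|^2 are recovered from these by polarization and test vectors. The
    formula for |T f|^2 as an integral is replaced by an inequality for step functions, which is why
    subdivisions and Riemann sums appear throughout. *)

Section complex_arith.
Context {R : realType}.
Implicit Types u v : R[i].
Local Notation Re := complex.Re.
Local Notation Im := complex.Im.

Lemma cReD u v : Re (u + v) = Re u + Re v.
Proof. by case: u v => ? ? []. Qed.

Lemma cImD u v : Im (u + v) = Im u + Im v.
Proof. by case: u v => ? ? []. Qed.

Lemma cReN u : Re (- u) = - Re u.
Proof. by case: u. Qed.

Lemma cImN u : Im (- u) = - Im u.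
Proof. by case: u. Qed.

Lemma cReM u v : Re (u * v) = Re u * Re v - Im u * Im v.
Proof. by case: u v => ? ? []. Qed.

Lemma cImM u v : Im (u * v) = Re u * Im v + Im u * Re v.
Proof. by case: u v => ? ? []. Qed.

Lemma cReJ u : Re (conjc u) = Re u.
Proof. by case: u. Qed.

Lemma cImJ u : Im (conjc u) = - Im u.
Proof. by case: u. Qed.

Definition cE := (cReD, cImD, cReN, cImN, cReM, cImM, cReJ, cImJ).

Lemma cmodE u : cmod u = Num.sqrt (Re u ^+ 2 + Im u ^+ 2).
Proof. by case: u. Qed.

Lemma cmod_ge0 u : 0 <= cmod u.
Proof. by rewrite cmodE sqrtr_ge0. Qed.

Lemma sqr_cmod u : cmod u ^+ 2 = Re u ^+ 2 + Im u ^+ 2.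
Proof. by rewrite cmodE sqr_sqrtr// addr_ge0// sqr_ge0. Qed.

Lemma cmod_eq0 u : cmod u = 0 -> u = 0.
Proof. exact: ComplexField.Normc.eq0_normc. Qed.

Lemma cmod_triangle u v : cmod (u + v) <= cmod u + cmod v.
Proof. exact: le_normcD. Qed.

End complex_arith.

Section L2.
Context {R : realType} {d : measure_display} {X : measurableType d}.
Variable mu : {measure set X -> \bar R}.
Implicit Types f g h : X -> R[i].
Local Notation Re := (@complex.Re R).
Local Notation Im := (@complex.Im R).
Local Notation L2 := (in_Lp mu 2).

Lemma eqae_sym f g : eqae mu f g -> eqae mu g f.
Proof. by apply: filterS => x ->. Qed.

(** The real part of the Hermitian product carries the whole argument: norms are unchanged, and the
    imaginary part is recovered by multiplying one factor by i. *)
Definition dot f g x : R := Re (f x) * Re (g x) + Im (f x) * Im (g x).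

Definition rip f g : R := \int[mu]_x dot f g x.

Lemma Re_inner f g : Re (inner mu f g) = rip f g.
Proof.
by rewrite /inner/= /rip; apply: eq_Rintegral => x _; rewrite !cE mulrN opprK.
Qed.

Lemma measurable_cmod f : measurable_fun setT (Re \o f) ->
  measurable_fun setT (Im \o f) -> measurable_fun setT (fun x => cmod (f x)).
Proof.
move=> mr mi.
rewrite (_ : (fun x => _) = (fun x => Num.sqrt (Re (f x) ^+ 2 + Im (f x) ^+ 2))).
  apply: (@measurableT_comp _ _ _ _ _ _ (@Num.sqrt R)).
    by apply: continuous_measurable_fun; exact: sqrt_continuous.
  by apply: measurable_funD; apply: measurable_funX; [exact: mr|exact: mi].
by apply/funext => x; rewrite cmodE.
Qed.

Lemma cnorm2E f : cnorm mu 2 f =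
  ((\int[mu]_x (dot f f x)%:E) `^ (2^-1))%E.
Proof.
rewrite /cnorm Lnorm.unlock; congr (_ `^ _)%E.
apply: eq_integral => x _; rewrite abse_EFin ger0_norm ?cmod_ge0//.
by rewrite poweR_EFin powR_mulrn ?cmod_ge0// sqr_cmod /dot !expr2.
Qed.

Lemma dot_ge0 f x : 0 <= dot f f x.
Proof. by rewrite /dot -!expr2 addr_ge0// sqr_ge0. Qed.

Lemma measurable_dot f g :
  measurable_fun setT (Re \o f) -> measurable_fun setT (Im \o f) ->
  measurable_fun setT (Re \o g) -> measurable_fun setT (Im \o g) ->
  measurable_fun setT (dot f g).
Proof. by move=> mrf mif mrg mig; apply: measurable_funD; exact: measurable_funM. Qed.

Lemma L2P f : L2 f <-> [/\ measurable_fun setT (Re \o f),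
  measurable_fun setT (Im \o f) & (\int[mu]_x (dot f f x)%:E < +oo)%E].
Proof.
have I0 : (0 <= \int[mu]_x (dot f f x)%:E)%E.
  by apply: integral_ge0 => x _; rewrite lee_fin dot_ge0.
split=> -[mr mi fin]; split => //; move: fin; rewrite cnorm2E.
  by apply: contraTT; rewrite -!leNgt !leye_eq => /eqP ->; rewrite poweRyr// invr_eq0.
by move=> fin; rewrite poweR_lty.
Qed.

Lemma dot_integrable f g : L2 f -> L2 g ->
  mu.-integrable setT (EFin \o dot f g).
Proof.
move=> /L2P[mrf mif If] /L2P[mrg mig Ig].
have sq h : measurable_fun setT (Re \o h) -> measurable_fun setT (Im \o h) ->
    (\int[mu]_x (dot h h x)%:E < +oo)%E -> mu.-integrable setT (EFin \o dot h h).
  move=> mr mi Ih; apply/integrableP; split.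
    by apply/measurable_EFinP; exact: measurable_dot.
  by under eq_integral do rewrite /= ger0_norm ?dot_ge0//.
apply: (le_integrable measurableT _ _
  (integrableD measurableT (sq f mrf mif If) (sq g mrg mig Ig))).
  by apply/measurable_EFinP; exact: measurable_dot.
move=> x _; rewrite /= lee_fin [leRHS]ger0_norm ?(addr_ge0 (dot_ge0 _ _) (dot_ge0 _ _))//.
rewrite /dot ler_norml.
set a := Re _; set b := Im _; set c := Re _; set e := Im _.
have := sqr_ge0 (a + c); have := sqr_ge0 (a - c).
have := sqr_ge0 (b + e); have := sqr_ge0 (b - e).
have := sqr_ge0 a; have := sqr_ge0 b; have := sqr_ge0 c; have := sqr_ge0 e.
nra.
Qed.

Lemma L2_lin (c : R[i]) f g : L2 f -> L2 g -> L2 (fun x => c * f x + g x).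
Proof.
move=> Lf Lg; have [mrf mif _] := Lf; have [mrg mig _] := Lg.
apply/L2P; split.
- rewrite (_ : _ \o _ =
    (fun x => (Re c * Re (f x) - Im c * Im (f x)) + Re (g x))).
    apply: measurable_funD => //; apply: measurable_funB; exact: measurable_funM.
  by apply/funext => x /=; rewrite !cE.
- rewrite (_ : _ \o _ =
    (fun x => (Re c * Im (f x) + Im c * Re (f x)) + Im (g x))).
    apply: measurable_funD => //; apply: measurable_funD; exact: measurable_funM.
  by apply/funext => x /=; rewrite !cE.
(* Expansion of |c f + g|^2; the imaginary part of the cross term is written as [dot] of i f and g,
   so that [dot_integrable] covers every term. *)
rewrite (_ : (fun x => _) = (fun x => ((Re c ^+ 2 + Im c ^+ 2)%:E * (dot f f x)%:E
  + ((2 * Re c)%:E * (dot f g x)%:E + ((2 * Im c)%:E * (dot (fun x => 'i%C * f x) g x)%:E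
  + (dot g g x)%:E)))%E)); last first.
  by apply/funext => x; rewrite -!EFinM -!EFinD /dot/= !cE/=; congr EFin; ring.
have Lif : L2 (fun x => 'i%C * f x).
  have /L2P[_ _ If] := Lf.
  apply/L2P; split.
  - rewrite (_ : _ \o _ = (fun x => - Im (f x))); first exact: measurableT_comp.
    by apply/funext => x /=; rewrite !cE/= mul0r mul1r add0r.
  - rewrite (_ : _ \o _ = (fun x => Re (f x))) //.
    by apply/funext => x /=; rewrite !cE/= mul0r mul1r add0r.
  rewrite (eq_integral (fun x => (dot f f x)%:E))// => x _.
  by rewrite /dot !cE/=; congr EFin; ring.
apply: integrable_lty => //.
apply: integrableD => //; first by apply: integrableZl => //; exact: dot_integrable.
apply: integrableD => //; first by apply: integrableZl => //; exact: dot_integrable.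
apply: integrableD => //; first by apply: integrableZl => //; exact: dot_integrable.
exact: dot_integrable.
Qed.

Lemma L2_0 : L2 (fun=> 0).
Proof.
apply/L2P; split; try exact: measurable_cst.
rewrite integral0_eq// => x _.
by rewrite /dot/= mul0r addr0.
Qed.

Lemma L2Z (c : R[i]) f : L2 f -> L2 (fun x => c * f x).
Proof.
move=> Lf; have := L2_lin c Lf L2_0.
by rewrite (_ : (fun x => _) = (fun x => c * f x))//; apply/funext => x; rewrite addr0.
Qed.

Lemma L2D f g : L2 f -> L2 g -> L2 (fun x => f x + g x).
Proof.
move=> Lf Lg; have := L2_lin 1 Lf Lg.
by rewrite (_ : (fun x => _) = (fun x => f x + g x))//; apply/funext => x; rewrite mul1r.
Qed.

Lemma L2B f g : L2 f -> L2 g -> L2 (fun x => f x - g x).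
Proof.
move=> Lf Lg; have := L2_lin (-1) Lg Lf.
rewrite (_ : (fun x => _) = (fun x => f x - g x))//; apply/funext => x.
by rewrite mulN1r addrC.
Qed.

Lemma L2_sum n (F : 'I_n -> X -> R[i]) : (forall i, L2 (F i)) ->
  L2 (fun x => \sum_(i < n) F i x).
Proof.
move=> LF; elim: n F LF => [|n IH] F LF.
  rewrite (_ : (fun x => _) = (fun=> 0)); first exact: L2_0.
  by apply/funext => x; rewrite big_ord0.
rewrite (_ : (fun x => _) =
  (fun x => (fun x => \sum_(i < n) F (widen_ord (leqnSn n) i) x) x + F ord_max x)).
  by apply: L2D => //; exact: IH.
by apply/funext => x; rewrite big_ord_recr.
Qed.

Lemma ripC f g : rip f g = rip g f.
Proof. by apply: eq_Rintegral => x _; rewrite /dot mulrC (mulrC (Im _)). Qed.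

Lemma rip_eqae f f' g : L2 f -> L2 f' -> L2 g -> eqae mu f f' ->
  rip f g = rip f' g.
Proof.
move=> [mr1 mi1 _] [mr2 mi2 _] [mr3 mi3 _] ff'; rewrite /rip /Rintegral; congr fine.
apply: ae_eq_integral => //; try by apply/measurable_EFinP; exact: measurable_dot.
by apply: filterS ff' => x xx _; rewrite /dot xx.
Qed.

Lemma ripDl f f' g : L2 f -> L2 f' -> L2 g ->
  rip (fun x => f x + f' x) g = rip f g + rip f' g.
Proof.
move=> Lf Lf' Lg; rewrite /rip -RintegralD//; try exact: dot_integrable.
by apply: eq_Rintegral => x _; rewrite /dot !cE; ring.
Qed.

Lemma ripZl (c : R) f g : L2 f -> L2 g ->
  rip (fun x => c%:C%C * f x) g = c * rip f g.
Proof.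
move=> Lf Lg; rewrite /rip -RintegralZl//; last exact: dot_integrable.
by apply: eq_Rintegral => x _; rewrite /dot !cE/=; ring.
Qed.

Lemma ripNl f g : L2 f -> L2 g -> rip (fun x => - f x) g = - rip f g.
Proof.
move=> Lf Lg; rewrite -mulN1r -ripZl//; congr rip.
by apply/funext => x; rewrite rmorphN1 mulN1r.
Qed.

Lemma ripBl f f' g : L2 f -> L2 f' -> L2 g ->
  rip (fun x => f x - f' x) g = rip f g - rip f' g.
Proof.
move=> Lf Lf' Lg; rewrite (ripDl Lf _ Lg) ?ripNl//.
have := L2Z (-1) Lf'; rewrite (_ : (fun x => _) = (fun x => - f' x))//.
by apply/funext => x; rewrite mulN1r.
Qed.

Lemma rip0l g : rip (fun=> 0) g = 0.
Proof.
rewrite /rip /Rintegral integral0_eq// => x _.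
by rewrite /dot/= !mul0r addr0.
Qed.

Lemma rip_suml n (F : 'I_n -> X -> R[i]) g : (forall i, L2 (F i)) -> L2 g ->
  rip (fun x => \sum_(i < n) F i x) g = \sum_(i < n) rip (F i) g.
Proof.
move=> LF Lg; elim: n F LF => [|n IH] F LF.
  rewrite big_ord0 (_ : (fun x => _) = (fun=> 0)) ?rip0l//.
  by apply/funext => x; rewrite big_ord0.
rewrite big_ord_recr/= -IH// -ripDl//; last exact: L2_sum.
by congr rip; apply/funext => x; rewrite big_ord_recr.
Qed.

Lemma rip_ge0 f : 0 <= rip f f.
Proof. by apply: Rintegral_ge0 => x _; exact: dot_ge0. Qed.

Lemma EFin_rip f : L2 f -> (rip f f)%:E = (\int[mu]_x (dot f f x)%:E)%E.
Proof.
by move=> Lf; rewrite /rip /Rintegral fineK//; apply: integrable_fin_num => //;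
  exact: dot_integrable.
Qed.

Lemma rip_eq0 f : L2 f -> rip f f = 0 -> eqae mu f (fun=> 0).
Proof.
move=> Lf ff0; have [mr mi _] := Lf.
have : (\int[mu]_x `|(dot f f x)%:E| = 0)%E.
  rewrite -[RHS](congr1 EFin ff0) EFin_rip//; apply: eq_integral => x _.
  by rewrite abse_EFin ger0_norm ?dot_ge0.
have me : measurable_fun setT (EFin \o dot f f).
  by apply/measurable_EFinP; exact: measurable_dot.
move=> /(ae_eq_integral_abs mu measurableT me).
apply: filterS => x /(_ Logic.I) [] => e; apply: cmod_eq0; apply/eqP.
by rewrite -sqrf_eq0 sqr_cmod !expr2 -/(dot f f x) e.
Qed.

Lemma cnorm2_rip f : L2 f -> cnorm mu 2 f = (Num.sqrt (rip f f))%:E.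
Proof. by move=> Lf; rewrite cnorm2E -EFin_rip// poweR_EFin powR12_sqrt// rip_ge0. Qed.

Lemma sqr_cnorm2 f : L2 f -> fine (cnorm mu 2 f) ^+ 2 = rip f f.
Proof. by move=> Lf; rewrite cnorm2_rip//= sqr_sqrtr// rip_ge0. Qed.

Lemma rip_sqrD (s : R) f g : L2 f -> L2 g ->
  rip (fun x => s%:C%C * f x + g x) (fun x => s%:C%C * f x + g x) =
  s ^+ 2 * rip f f + 2 * s * rip f g + rip g g.
Proof.
move=> Lf Lg; have Lsf := L2Z s%:C%C Lf; have LD := L2D Lsf Lg.
rewrite [LHS]ripDl// ripZl// [rip f _]ripC [rip g _]ripC !ripDl// !ripZl//.
by rewrite [rip g f]ripC; ring.
Qed.

Lemma rip_CauchySchwarz f g : L2 f -> L2 g ->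
  rip f g <= Num.sqrt (rip f f) * Num.sqrt (rip g g).
Proof.
move=> Lf Lg; set a := Num.sqrt _; set b := Num.sqrt _.
have a2 : a ^+ 2 = rip f f by rewrite sqr_sqrtr// rip_ge0.
have b2 : b ^+ 2 = rip g g by rewrite sqr_sqrtr// rip_ge0.
have a0 : 0 <= a by exact: sqrtr_ge0.
have b0 : 0 <= b by exact: sqrtr_ge0.
have P s : 0 <= s ^+ 2 * a ^+ 2 - 2 * s * rip f g + b ^+ 2.
  have := rip_ge0 (fun x => (- s)%:C%C * f x + g x).
  by rewrite rip_sqrD// a2 b2 sqrrN mulrN mulNr.
have [a00|an0] := eqVneq a 0.
  (* For a = 0 the polynomial is affine in s, and this s gives it the value -1 unless <f, g> = 0.
     For a > 0 its minimum, at <f, g> / a^2, is used instead. *)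
  have := P ((b ^+ 2 + 1) / 2 / (rip f g)); rewrite a00 expr0n/= mulr0 mul0r add0r.
  have [->|c0] := eqVneq (rip f g) 0; first by [].
  by rewrite (_ : 2 * _ * _ = b ^+ 2 + 1); [lra|field].
have ap : 0 < a by rewrite lt0r an0.
have := P (rip f g / a ^+ 2).
rewrite (_ : _ + _ = b ^+ 2 - (rip f g / a) ^+ 2); last by field.
rewrite subr_ge0 => rb; rewrite mulrC -ler_pdivrMr//.
by rewrite (le_trans (ler_norm _))// -[leRHS](ger0_norm b0) -!sqrtr_sqr ler_wsqrtr.
Qed.

Lemma norm_rip_le f g : L2 f -> L2 g ->
  `|rip f g| <= Num.sqrt (rip f f) * Num.sqrt (rip g g).
Proof.
move=> Lf Lg; rewrite ler_norml rip_CauchySchwarz// andbT lerNl -ripNl//.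
have LN : L2 (fun x => - f x).
  have := L2Z (-1) Lf; rewrite (_ : (fun x => _) = (fun x => - f x))//.
  by apply/funext => x; rewrite mulN1r.
apply: le_trans (rip_CauchySchwarz LN Lg) _; rewrite ripNl// ripC ripNl// opprK //.
Qed.

End L2.
(** * Spectral measures and spectral integrals *)

Section spectral_measure.
Context {R : realType} {d : measure_display} {X : measurableType d}.
Context {mu : {measure set X -> \bar R}} {E : set R -> operator mu}.
Hypothesis hE : projection_valued_measure E.
Implicit Types f g h : X -> R[i].
Implicit Types B C : set R.
Local Notation L2 := (in_Lp mu 2).
Local Notation rip := (rip mu).

Lemma E_L2 B f : measurable B -> L2 f -> L2 (E B f).
Proof. by move=> mB Lf; apply: op_L2; rewrite (pvm_dom hE mB). Qed.

Lemma E_sym B f g : measurable B -> L2 f -> L2 g ->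
  rip (E B f) g = rip f (E B g).
Proof. by move=> mB Lf Lg; rewrite -!Re_inner (pvm_sym hE). Qed.

Lemma rip_EE B C f g : measurable B -> measurable C -> L2 f -> L2 g ->
  rip (E B f) (E C g) = rip (E (B `&` C) f) g.
Proof.
move=> mB mC Lf Lg; have mBC : measurable (B `&` C) by exact: measurableI.
have ? := E_L2 mC Lg; have ? := E_L2 mB Lf.
rewrite E_sym// [RHS]E_sym// ripC [RHS]ripC; apply: rip_eqae => //.
- exact: E_L2.
- exact: E_L2.
- exact/eqae_sym/(pvm_setI hE).
Qed.

Definition spectral_mass f B : R := rip (E B f) f.
Local Notation nu := spectral_mass.

Lemma nu_sqr f B : measurable B -> L2 f -> nu f B = rip (E B f) (E B f).
Proof. by move=> mB Lf; rewrite rip_EE// setIid. Qed.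

Lemma nu_ge0 f B : measurable B -> L2 f -> 0 <= nu f B.
Proof. by move=> mB Lf; rewrite nu_sqr// rip_ge0. Qed.

Lemma nu_setT f : L2 f -> nu f setT = rip f f.
Proof. by move=> Lf; apply: rip_eqae => //; [exact: E_L2|exact: pvm_setT]. Qed.

Lemma nu_restr f B C : measurable B -> measurable C -> L2 f ->
  nu (E B f) C = nu f (C `&` B).
Proof.
move=> mB mC Lf; rewrite {1}/nu.
have LB := E_L2 mB Lf; have mBC : measurable (B `&` C) by exact: measurableI.
by rewrite E_sym// rip_EE// rip_EE// setIAC setIid setIC.
Qed.

Lemma E_set0 f g : L2 f -> L2 g -> rip (E set0 f) g = 0.
Proof.
move=> Lf Lg; rewrite (@rip_eqae _ _ _ _ _ (fun=> 0)) ?rip0l//.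
- exact: E_L2.
- exact: L2_0.
- exact: pvm_set0.
Qed.

Lemma rip_E_sum n (B : 'I_n -> set R) (a b : 'I_n -> R) f g :
  (forall i, measurable (B i)) -> (forall i j, i != j -> B i `&` B j = set0) ->
  L2 f -> L2 g ->
  rip (fun x => \sum_(i < n) (a i)%:C%C * E (B i) f x)
      (fun x => \sum_(i < n) (b i)%:C%C * E (B i) g x) =
  \sum_(i < n) a i * b i * rip (E (B i) f) g.
Proof.
move=> mB tB Lf Lg.
have LEf i : L2 (E (B i) f) by exact: E_L2.
have LEg i : L2 (E (B i) g) by exact: E_L2.
have La i : L2 (fun x => (a i)%:C%C * E (B i) f x) by exact: L2Z.
have Lb i : L2 (fun x => (b i)%:C%C * E (B i) g x) by exact: L2Z.
rewrite rip_suml//; last exact: L2_sum.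
apply: eq_bigr => i _; rewrite ripZl//; last exact: L2_sum.
rewrite ripC rip_suml// (bigD1 i)//= big1 ?addr0.
  by rewrite ripZl// ripC rip_EE// setIid mulrA.
by move=> j ji; rewrite ripZl// rip_EE// tB// E_set0 ?mulr0.
Qed.

(** On non-measurable sets [E B] is unconstrained, so the set function is replaced by 0 there and
    agreement is asserted on measurable sets only. Countable additivity is the norm convergence of
    [pvm_bigcup], paired with f by Cauchy-Schwarz. *)
Lemma spectral_measure_ex f : L2 f -> exists m : {measure set R -> \bar R},
  forall B, measurable B -> m B = (nu f B)%:E.
Proof.
move=> Lf; pose m B : \bar R := if pselect (measurable B) then (nu f B)%:E else 0%E.
have mE B : measurable B -> m B = (nu f B)%:E by rewrite /m; case: pselect.
have m0 : m set0 = 0%E.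
  by rewrite mE// /nu E_set0.
have m_ge0 B : (0 <= m B)%E.
  by rewrite /m; case: pselect => // mB; rewrite lee_fin nu_ge0.
have madd : semi_sigma_additive m.
  move=> F mF tF mUF; rewrite mE//.
  have -> : (fun n => \sum_(0 <= i < n) m (F i))%E =
            EFin \o (fun n => \sum_(i < n) nu f (F i)).
    by apply/funext => n /=; rewrite big_mkord -sumEFin; apply: eq_bigr => i _; rewrite mE.
  apply: cvg_EFin; first by near=> n.
  pose h n x := E (\bigcup_k F k) f x - \sum_(k < n) E (F k) f x.
  have LE k : L2 (E (F k) f) by exact: E_L2.
  have Lh n : L2 (h n) by apply: L2B; [exact: E_L2|exact: L2_sum].
  have hn n : nu f (\bigcup_k F k) - \sum_(i < n) nu f (F i) = rip (h n) f.
    rewrite /h ripBl//; [|exact: E_L2|exact: L2_sum].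
    by rewrite rip_suml.
  have h0 : (fun n => fine (cnorm mu 2 (h n))) @ \oo --> (0 : R).
    exact: (fine_cvg (pvm_bigcup hE mF tF Lf)).
  have : (fun n => fine (cnorm mu 2 (h n)) * Num.sqrt (rip f f)) @ \oo --> (0 : R).
    by rewrite -[X in _ --> X](mul0r (Num.sqrt (rip f f))); apply: cvgMl.
  move=> /cvgrPdist_le => H; apply/cvgrPdist_le => e e0.
  move: (H e e0); apply: filterS => n /= H'; rewrite hn.
  apply: le_trans (norm_rip_le (Lh n) Lf) _.
  apply: le_trans H'; rewrite sub0r normrN cnorm2_rip//=.
  by rewrite ger0_norm// mulr_ge0// sqrtr_ge0.
pose mm := isMeasure.Build _ _ _ m m0 m_ge0 madd.
pose M : {measure set R -> \bar R} := HB.pack m mm.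
by exists M.
Unshelve. all: by end_near. Qed.

End spectral_measure.

(** * Integrals against set functions and finite measures *)

Section integral_lemmas.
Context {d : measure_display} {T : measurableType d} {R : realType}.
Implicit Types m : {measure set T -> \bar R}.
Local Open Scope ereal_scope.
Import HBNNSimple.

(* Here [n] is only a set function, which need not be a measure on
   non-measurable sets. *)
Lemma eq_setfun_integral (n : set T -> \bar R) m (f : T -> \bar R) :
  (forall A, measurable A -> n A = m A) -> \int[n]_x f x = \int[m]_x f x.
Proof.
move=> nm; rewrite /integral; congr (ereal_sup _ - ereal_sup _);
  by apply: eq_imagel => h _; apply: eq_fsbigr => r _; rewrite nm.
Qed.

Lemma ae_bound_integral m (B : set T) (phi : T -> R) (K : R) :
  (m setT < +oo) -> m.-integrable setT (EFin \o phi) -> measurable B ->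
  m (~` B) = 0 -> (forall t, B t -> (phi t <= K)%R) ->
  \int[m]_x (phi x)%:E <= K%:E * m setT.
Proof.
move=> mfin iphi mB mB0 phiK.
have mCB := measurableC mB.
have mBT : m setT = m B.
  by rewrite -(setUv B) measureU ?setICr//= mB0 adde0.
rewrite (negligible_integral mCB measurableT iphi mB0) setTD setCK mBT.
rewrite -(integral_cst m mB); apply: le_integral => //.
- by apply: integrableS iphi.
- apply/integrableP; split => //.
  rewrite (eq_integral (cst `|K%:E|)) ?integral_cst//.
  by rewrite -mBT abse_EFin lte_mul_pinfty.
- by move=> t /set_mem Bt; rewrite lee_fin phiK.
Qed.

Lemma ae_bound_integral_ge m (B : set T) (phi : T -> R) (K : R) :
  (m setT < +oo) -> m.-integrable setT (EFin \o phi) -> measurable B ->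
  m (~` B) = 0 -> (forall t, B t -> (K <= phi t)%R) ->
  K%:E * m setT <= \int[m]_x (phi x)%:E.
Proof.
move=> mfin iphi mB mB0 phiK.
have mCB := measurableC mB.
have mBT : m setT = m B.
  by rewrite -(setUv B) measureU ?setICr//= mB0 adde0.
rewrite (negligible_integral mCB measurableT iphi mB0) setTD setCK mBT.
rewrite -(integral_cst m mB); apply: le_integral => //.
- apply/integrableP; split => //.
  rewrite (eq_integral (cst `|K%:E|)) ?integral_cst//.
  by rewrite -mBT abse_EFin lte_mul_pinfty.
- by apply: integrableS iphi.
- by move=> t /set_mem Bt; rewrite lee_fin phiK.
Qed.

End integral_lemmas.

(** * Recovering an operator from its quadratic values *)

Section spectral_integral.
Context {R : realType} {d : measure_display} {X : measurableType d}.
Context {mu : {measure set X -> \bar R}} {E : set R -> operator mu}.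
Hypothesis hE : projection_valued_measure E.
Variables (phi : R -> R) (T : operator mu).
Hypothesis mphi : measurable_fun setT phi.
Hypothesis hT : spectral_integral E phi T.
Implicit Types f g h : X -> R[i].
Implicit Types B C : set R.
Local Notation L2 := (in_Lp mu 2).
Local Notation rip := (rip mu).
Local Notation nu := (spectral_mass (E := E)).

Let m2phi : measurable_fun setT (fun t => ((phi t) ^+ 2)%:E).
Proof. by apply/measurable_EFinP; exact: measurable_funX. Qed.

Let m_eq f (m : {measure set R -> \bar R}) (g : R -> \bar R) :
  (forall B, measurable B -> m B = (nu f B)%:E) ->
  (\int[spectral_dist E f]_t g t = \int[m]_t g t)%E.
Proof.
move=> mE; apply: eq_setfun_integral => B mB.
by rewrite mE// /spectral_dist Re_inner.
Qed.

Let m_setT f (m : {measure set R -> \bar R}) : L2 f ->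
  (forall B, measurable B -> m B = (nu f B)%:E) -> m setT = (rip f f)%:E.
Proof. by move=> Lf ->//; rewrite nu_setT. Qed.

Let domP f (m : {measure set R -> \bar R}) : L2 f ->
  (forall B, measurable B -> m B = (nu f B)%:E) ->
  dom T f <-> (\int[m]_t ((phi t) ^+ 2)%:E < +oo)%E.
Proof.
by move=> Lf mE; rewrite hT.1/= (m_eq _ mE); split=> [[]|].
Qed.

(** The spectral measure of f is finite, so |phi| <= 1 + phi^2 turns square integrability into
    integrability. This makes the [fine] in [spectral_integral] a genuine value. *)
Let dom_integrable f (m : {measure set R -> \bar R}) : dom T f ->
  (forall B, measurable B -> m B = (nu f B)%:E) ->
  m.-integrable setT (EFin \o phi).
Proof.
move=> domf mE; have Lf := dom_L2 domf.
have If := (domP Lf mE).1 domf.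
have I1 : m.-integrable setT (fun t => (1%:E + ((phi t) ^+ 2)%:E)%E).
  apply: integrableD => //.
    apply/integrableP; split => //.
    rewrite (eq_integral (cst 1%:E)); last by move=> x _; rewrite abse_EFin normr1.
    by rewrite integral_cst// mul1e (m_setT Lf mE) ltry.
  apply/integrableP; split => //.
  by under eq_integral do rewrite abse_EFin ger0_norm ?sqr_ge0//.
apply: le_integrable I1 => //; first by apply/measurable_EFinP.
move=> t _; rewrite /= lee_fin [leRHS]ger0_norm ?addr_ge0 ?sqr_ge0//.
rewrite ler_norml; have := sqr_ge0 (phi t - 1); have := sqr_ge0 (phi t + 1).
nra.
Qed.

Let quadE f (m : {measure set R -> \bar R}) : dom T f ->
  (forall B, measurable B -> m B = (nu f B)%:E) ->
  (rip (T f) f)%:E = (\int[m]_t (phi t)%:E)%E.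
Proof.
move=> domf mE; rewrite -Re_inner hT.2//= (m_eq _ mE) fineK//.
by apply: integrable_fin_num => //; exact: dom_integrable mE.
Qed.

Lemma quad_le f B (K : R) : dom T f -> measurable B -> nu f (~` B) = 0 ->
  (forall t, B t -> phi t <= K) -> rip (T f) f <= K * rip f f.
Proof.
move=> domf mB nuB phiK; have Lf := dom_L2 domf.
have [m mE] := spectral_measure_ex hE Lf.
rewrite -lee_fin (quadE domf mE) EFinM -(m_setT Lf mE).
apply: (ae_bound_integral (B := B)) => //.
- by rewrite (m_setT Lf mE) ltry.
- exact: dom_integrable mE.
- by rewrite mE ?nuB//; exact: measurableC.
Qed.

Lemma quad_ge f B (K : R) : dom T f -> measurable B -> nu f (~` B) = 0 ->
  (forall t, B t -> K <= phi t) -> K * rip f f <= rip (T f) f.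
Proof.
move=> domf mB nuB phiK; have Lf := dom_L2 domf.
have [m mE] := spectral_measure_ex hE Lf.
rewrite -lee_fin (quadE domf mE) EFinM -(m_setT Lf mE).
apply: (ae_bound_integral_ge (B := B)) => //.
- by rewrite (m_setT Lf mE) ltry.
- exact: dom_integrable mE.
- by rewrite mE ?nuB//; exact: measurableC.
Qed.

Lemma nu_compl f B : measurable B -> L2 f -> nu (E B f) (~` B) = 0.
Proof.
move=> mB Lf; have mC := measurableC mB.
by rewrite nu_restr// setICl /nu E_set0.
Qed.

Lemma dom_E f B : measurable B -> dom T f -> dom T (E B f).
Proof.
move=> mB domf; have Lf := dom_L2 domf; have LE := E_L2 hE mB Lf.
have [m mE] := spectral_measure_ex hE Lf.
have [m' mE'] := spectral_measure_ex hE LE.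
apply/(domP LE mE'); apply: le_lt_trans ((domP Lf mE).1 domf).
apply: ge0_le_measure_integral => //.
- move=> S mS; rewrite mE'// nu_restr// -mE; last exact: measurableI.
  by apply: le_measure => //; rewrite ?inE//; exact: measurableI.
- by move=> t; rewrite lee_fin sqr_ge0.
Qed.

Lemma dom_E_bounded f B (K : R) : measurable B -> L2 f ->
  (forall t, B t -> phi t ^+ 2 <= K) -> dom T (E B f).
Proof.
move=> mB Lf phiK; have LE := E_L2 hE mB Lf.
have [m mE] := spectral_measure_ex hE LE.
apply/(domP LE mE).
rewrite (@ge0_negligible_integral _ _ _ _ _ (~` B))//.
- rewrite setTD setCK.
  apply: (@le_lt_trans _ _ (\int[m]_(t in B) (cst `|K|%:E) t)%E).
    apply: ge0_le_integral => //.
    + by move=> t _; rewrite lee_fin sqr_ge0.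
    + exact: measurable_funTS.
    + by move=> t Bt; rewrite lee_fin (le_trans (phiK t Bt))// ler_norm.
  by rewrite integral_cst// lte_mul_pinfty// mE// ltry.
- exact: measurableC.
- by move=> t _; rewrite lee_fin sqr_ge0.
- by rewrite mE ?nu_compl//; exact: measurableC.
Qed.

Lemma T_L2 f : dom T f -> L2 (T f).
Proof. exact: op_L2. Qed.

Lemma rip_lin (c : R) f g h : L2 f -> L2 g -> L2 h ->
  rip (fun x => c%:C%C * f x + g x) h = c * rip f h + rip g h.
Proof. by move=> Lf Lg Lh; rewrite (ripDl (L2Z _ Lf))// ripZl. Qed.

Lemma T_lin (c : R[i]) f g h : dom T f -> dom T g -> L2 h ->
  rip (T (fun x => c * f x + g x)) h = rip (fun x => c * T f x + T g x) h.
Proof.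
move=> df dg Lh; apply: rip_eqae => //; last exact: op_lin.
- by apply: T_L2; exact: dom_lin.
- by apply: L2_lin; exact: T_L2.
Qed.

Lemma ripJ f g : rip (fun x => 'i%C * f x) (fun x => 'i%C * g x) = rip f g.
Proof. by apply: eq_Rintegral => x _; rewrite /dot !cE/=; ring. Qed.

(** The left-hand side is the imaginary part of <T f, f>, which [spectral_integral] sets to 0; all
    symmetry of T is drawn from this. *)
Lemma T_quad_im f : dom T f -> rip (T f) (fun x => 'i%C * f x) = 0.
Proof.
move=> domf; have := congr1 (@complex.Im R) (hT.2 f domf).
rewrite /inner/= => e; rewrite -[RHS]e; apply: eq_Rintegral => x _; rewrite /dot !cE/=; ring.
Qed.

(* Polarization of a real quadratic form: test [T_quad_im] on i f + g. *)
Lemma T_sym f g : dom T f -> dom T g -> rip (T f) g = rip f (T g).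
Proof.
move=> df dg; have := T_quad_im (dom_lin 'i%C df dg).
have Lf := dom_L2 df; have Lg := dom_L2 dg.
have LTf := T_L2 df; have LTg := T_L2 dg.
have LJ h : L2 h -> L2 (fun x => 'i%C * h x) by exact: L2Z.
have LN h : L2 h -> L2 (fun x => (-1)%:C%C * h x) by exact: L2Z.
rewrite T_lin//; last by apply: L2Z; exact: L2_lin.
rewrite (_ : (fun x => 'i%C * ('i%C * f x + g x)) =
             (fun x => (-1)%:C%C * f x + 'i%C * g x)); last first.
  by apply/funext => x; rewrite mulrDr mulrA -expr2 sqr_i rmorphN1.
have LR : L2 (fun x => (-1)%:C%C * f x + 'i%C * g x) by apply: L2_lin => //; exact: LJ.
rewrite (ripDl (LJ _ LTf) LTg LR) ripC (rip_lin _ Lf (LJ _ Lg) (LJ _ LTf)).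
rewrite [rip (T g) _]ripC (rip_lin _ Lf (LJ _ Lg) LTg).
rewrite ripJ [rip (fun x => 'i%C * g x) (T g)]ripC (T_quad_im dg).
rewrite (_ : rip f (fun x => 'i%C * T f x) = 0).
  by rewrite [rip g (T f)]ripC; lra.
transitivity (- rip (T f) (fun x => 'i%C * f x)); last by rewrite T_quad_im// oppr0.
rewrite -ripNl//; last exact: LJ.
by apply: eq_Rintegral => x _; rewrite /dot !cE/=; ring.
Qed.

(* Under this orthogonality the spectral measures of f and g add up to that of
   f + g, hence so do the quadratic values of T. *)
Lemma T_cross f g : dom T f -> dom T g ->
  (forall C, measurable C -> rip (E C f) g = 0) -> rip (T f) g = 0.
Proof.
move=> df dg fg0; have Lf := dom_L2 df; have Lg := dom_L2 dg.
have [mf mfE] := spectral_measure_ex hE Lf.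
have [mg mgE] := spectral_measure_ex hE Lg.
pose u x := 1%:C%C * f x + g x.
have du : dom T u by exact: dom_lin.
have Lu := dom_L2 du.
have [m mE] := spectral_measure_ex hE Lu.
have nuD B : measurable B -> nu u B = nu f B + nu g B.
  move=> mB; have Lw := E_L2 hE mB Lu.
  have LBf := E_L2 hE mB Lf; have LBg := E_L2 hE mB Lg.
  rewrite /nu ripC {1}/u rip_lin// -!E_sym// [rip (E B f) u]ripC.
  rewrite [rip (E B g) u]ripC /u !rip_lin// -(E_sym hE mB Lf Lg) fg0//.
  by rewrite [rip g (E B f)]ripC fg0// [rip f (E B f)]ripC [rip g (E B g)]ripC; ring.
have q : rip (T u) u = rip (T f) f + rip (T g) g.
  apply: EFin_inj; rewrite EFinD (quadE du mE) (quadE df mfE) (quadE dg mgE).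
  have If := dom_integrable df mfE; have Ig := dom_integrable dg mgE.
  rewrite -integral_measure_add//.
  apply: eq_measure_integral => B mB _.
  by rewrite [RHS]measure_addE mE// mfE// mgE// -EFinD nuD.
(* Expanding <T u, u> bilinearly leaves two cross terms, equal by [T_sym]; additivity of the
   quadratic values makes their sum vanish. *)
move: q; have LTf := T_L2 df; have LTg := T_L2 dg.
rewrite {1}/u T_lin// rip_lin// [rip (T f) u]ripC [rip (T g) u]ripC /u !rip_lin//.
rewrite -(T_sym df dg) [rip g (T f)]ripC [rip f (T f)]ripC [rip g (T g)]ripC.
lra.
Qed.

(** A weak form of the commutation of T with E(B): f - E(B) f and E(B) g are orthogonal under every
    spectral projection, so [T_cross] applies to them. *)
Lemma T_E f g B : measurable B -> dom T f -> dom T g ->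
  rip (T f) (E B g) = rip (T (E B f)) (E B g).
Proof.
move=> mB df dg; have Lf := dom_L2 df; have Lg := dom_L2 dg.
have dEf := dom_E mB df; have dEg := dom_E mB dg.
have LEf := dom_L2 dEf; have LEg := dom_L2 dEg.
have := @T_cross (fun x => (-1)%:C%C * E B f x + f x) (E B g) (dom_lin _ dEf df) dEg.
rewrite T_lin// rip_lin//; [|exact: T_L2|exact: T_L2].
move=> H; suff: -1 * rip (T (E B f)) (E B g) + rip (T f) (E B g) = 0 by lra.
apply: H => C mC; have LC := E_L2 hE mC LEg.
rewrite E_sym//; last exact: L2_lin.
rewrite rip_lin// -(E_sym hE mC Lf LEg) !rip_EE//; last exact: measurableI.
by rewrite setIAC setIid setIC mulN1r addNr.
Qed.

(** Lower sums of phi^2 for the spectral measure stay below |T f|^2. This one-sided estimate is all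
    that the energy is asked for later, with phi the square root. The vector h is a step function
    version of T f, and <T f, h> >= |h|^2 since phi >= a i on each piece. *)
Lemma quad_sum_le n (B : 'I_n -> set R) (a : 'I_n -> R) f : dom T f ->
  (forall i, measurable (B i)) -> (forall i j, i != j -> B i `&` B j = set0) ->
  (forall i, 0 <= a i) -> (forall i t, B i t -> a i <= phi t) ->
  \sum_(i < n) a i ^+ 2 * nu f (B i) <= rip (T f) (T f).
Proof.
move=> df mB tB a0 aphi; have Lf := dom_L2 df; have LTf := T_L2 df.
have LE i : L2 (E (B i) f) by exact: E_L2.
have LaE i : L2 (fun x => (a i)%:C%C * E (B i) f x) by exact: L2Z.
pose h x := \sum_(i < n) (a i)%:C%C * E (B i) f x.
have Lh : L2 h by exact: L2_sum.
have hh : rip h h = \sum_(i < n) a i ^+ 2 * nu f (B i).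
  by rewrite rip_E_sum//; apply: eq_bigr => i _; rewrite expr2.
have Th : rip h h <= rip (T f) h.
  rewrite hh ripC /h rip_suml//; apply: ler_sum => i _.
  have dE := dom_E (mB i) df.
  rewrite ripZl// ripC T_E// expr2 -mulrA ler_wpM2l//.
  rewrite nu_sqr//; apply: quad_ge (aphi i) => //.
  exact: nu_compl.
(* |T f - h|^2 >= 0 with <T f, h> >= |h|^2. *)
have := rip_ge0 mu (fun x => (-1)%:C%C * h x + T f x).
rewrite rip_sqrD// [rip h (T f)]ripC -hh; lra.
Qed.

End spectral_integral.
(** * The Stieltjes integral of dF(u)/u *)

Section stieltjes_lemmas.
Context {R : realType}.
Variables (F : R -> \bar R) (F_ge0 : forall u, (0 <= F u)%E).
Local Notation Fr := (right_limit F_ge0).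
Local Notation m := (lebesgue_stieltjes_measure (right_limit F_ge0)).
Local Notation G := (stieltjes_inv F_ge0).

Lemma right_limit_ge l x : 0 <= l -> (forall u, l < u -> x <= fine (F u)) -> x <= Fr l.
Proof.
move=> l0 xF; rewrite /right_limit ltNge l0/=; apply: lb_le_inf.
  by exists (fine (F (l + 1))), (l + 1) => //=; rewrite in_itv/= ltrDl ltr01.
by move=> _ [u /= + <-]; rewrite in_itv/= andbT => /xF.
Qed.

Lemma stieltjes_oc a b : a <= b -> m `]a, b]%classic = (Fr b - Fr a)%:E.
Proof.
move=> ab; rewrite /lebesgue_stieltjes_measure /measure_extension/=.
by rewrite measurable_mu_extE/= ?wlength_itv_bnd//; exact: is_ocitv.
Qed.

Lemma le_right_limit a b : a <= b -> Fr a <= Fr b.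
Proof.
by move=> ab; rewrite -subr_ge0 -lee_fin -stieltjes_oc// measure_ge0.
Qed.

(** The integrator is constant on the negative reals; the open end at 0 leaves out the atom that a
    jump there would create. *)
Lemma stieltjes_neg : m `]-1, 0[%classic = 0%E.
Proof.
rewrite (_ : `]-1, 0[%classic = \bigcup_k `]-1, - k.+1%:R^-1]%classic); last first.
  apply/seteqP; split=> [x|x [k _]] /=; rewrite !in_itv/= => /andP[x1 x0].
    have nx : 0 < - x by rewrite oppr_gt0.
    exists (Num.bound (- x)^-1) => //=; rewrite in_itv/= x1/= lerNr.
    rewrite invf_ple ?posrE// (le_trans (ltW (archi_boundP _)))// ?invr_ge0 ?ltW//.
    by rewrite ltr_nat.
  by rewrite x1 (le_lt_trans x0)// oppr_lt0 invr_gt0.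
apply/negligibleP; first exact: bigcup_measurable.
apply: negligible_bigcup => k; apply/negligibleP => //.
apply: (etrans (stieltjes_oc _)); first by rewrite lerN2 invf_le1// ler1n.
by rewrite /right_limit !oppr_lt0 ltr01 invr_gt0 ltr0n subrr.
Qed.

Lemma stieltjes_0c a : 0 <= a -> m `[0, a]%classic = (Fr a)%:E.
Proof.
move=> a0; have := @stieltjes_oc (-1) a.
rewrite (_ : `]-1, a]%classic = `]-1, 0[%classic `|` `[0, a]%classic); last first.
  by rewrite -itv_bndbnd_setU// bnd_simp// oppr_le0.
rewrite measureU//=; last first.
  apply/seteqP; split => x //=; rewrite !in_itv/= => -[/andP[_ x0] /andP[x1 _]].
  by move: x0; rewrite ltNge x1.
rewrite stieltjes_neg add0e => -> //; last by rewrite (le_trans _ a0)// oppr_le0.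
by rewrite {2}/right_limit oppr_lt0 ltr01 subr0.
Qed.

Let inv_ge0 (D : set R) : D `<=` `[0, +oo[%classic ->
  forall x, D x -> (0 <= (x%:E)^-1)%E.
Proof.
by move=> D0 x /D0 /=; rewrite in_itv/= andbT => x0; rewrite inve_ge0.
Qed.

Let measurable_inv (D : set R) : D `<=` `[0, +oo[%classic ->
  measurable_fun D (fun x : R => (x%:E)^-1)%E.
Proof.
move=> D0; apply: (@eq_measurable_fun _ _ _ _ _
    (fun x : R => if x == 0 then +oo%E else (x `^ (-1))%:E)).
  move=> x /set_mem /D0 /=; rewrite in_itv/= andbT => x0.
  by rewrite powR_inv1// inver.
apply: measurable_funTS; apply: measurable_fun_ifT => //=.
  exact: measurable_fun_eqr.
by apply/measurable_EFinP; exact: measurable_powR.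
Qed.

Lemma stieltjes_inv_le a b : a <= b -> (G a <= G b)%E.
Proof.
move=> ab; apply: ge0_subset_integral => //.
- by apply: measurable_inv => x /=; rewrite !in_itv/= => /andP[->].
- by apply: inv_ge0 => x /=; rewrite !in_itv/= => /andP[->].
- by move=> x /=; rewrite !in_itv/= => /andP[-> xa]; rewrite (le_trans xa).
Qed.

Lemma stieltjes_inv_ge0 a : (0 <= G a)%E.
Proof.
by apply: integral_ge0; apply: inv_ge0 => x /=; rewrite !in_itv/= => /andP[->].
Qed.

Let integral_inv_ge (D : set R) b : 0 < b -> measurable D -> D `<=` `[0, b]%classic ->
  ((b^-1)%:E * m D <= \int[m]_(u in D) (u%:E)^-1)%E.
Proof.
move=> b0 mD Db; rewrite -integral_cst//; apply: ge0_le_integral => //.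
- by move=> x _; rewrite lee_fin invr_ge0 ltW.
- by apply: measurable_inv => x /Db /=; rewrite !in_itv/= => /andP[->].
move=> x /Db /=; rewrite in_itv/= => /andP[x0 xb].
have [->|xn0] := eqVneq x 0; first by rewrite inve0 leey.
by rewrite -[leRHS]/((x%:E)^-1)%E inver (negbTE xn0) lee_fin lef_pV2 ?posrE// lt0r xn0.
Qed.

Lemma stieltjes_inv_ge a : 0 < a -> ((a^-1 * Fr a)%:E <= G a)%E.
Proof.
move=> a0; rewrite EFinM -stieltjes_0c ?(ltW a0)//; exact: (integral_inv_ge a0).
Qed.

(** On ]a, b] one has 1/u >= 1/b. Together with [stieltjes_inv_ge] for the initial interval, this is
    how the Abel summation consumes G. *)
Lemma stieltjes_inv_step a b : 0 < a -> a <= b ->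
  (G a + (b^-1 * (Fr b - Fr a))%:E <= G b)%E.
Proof.
move=> a0 ab; have b0 := lt_le_trans a0 ab.
rewrite {2}/stieltjes_inv (_ : `[0, b]%classic = `[0, a]%classic `|` `]a, b]%classic); last first.
  by rewrite -itv_bndbnd_setU// bnd_simp// ltW.
rewrite ge0_integral_setU//=; first last.
- apply/disj_setPRL => x /=; rewrite !in_itv/= => /andP[ax _].
  by apply/negP; rewrite negb_and -(ltNge a) ax orbT.
- by apply: inv_ge0 => x /= [|]; rewrite !in_itv/= => /andP[+ _];
    [move=> ->|move=> /ltW ax; rewrite (le_trans (ltW a0))].
- by apply: measurable_inv => x /= [|]; rewrite !in_itv/= => /andP[+ _];
    [move=> ->|move=> /ltW ax; rewrite (le_trans (ltW a0))].
rewrite leeD2l// EFinM -stieltjes_oc//; apply: integral_inv_ge => //.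
by move=> x /=; rewrite !in_itv/= => /andP[ax ->]; rewrite (le_trans (ltW a0)) ?ltW.
Qed.

(** As 0^-1 = +oo, an atom of the Stieltjes measure at 0 would make G infinite everywhere on [0,
    +oo[; finiteness of G thus forces F(0+) = 0. *)
Lemma stieltjes_inv0 : (G 1 < +oo)%E -> G 0 = 0%E.
Proof.
move=> G1; have G0 : (G 0 < +oo)%E by apply: le_lt_trans G1; exact: stieltjes_inv_le.
have : G 0 = (+oo * m [set 0%R])%E.
  rewrite /stieltjes_inv set_itv1 -integral_cst//; apply: eq_integral => x.
  by rewrite inE => ->; rewrite inve0.
have [->|m0] := eqVneq (m [set 0%R]) 0%E; first by rewrite mule0.
rewrite gt0_mulye; first by move=> G0y; rewrite G0y in G0.
by rewrite lt0e m0 measure_ge0.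
Qed.

End stieltjes_lemmas.
(** * Orthogonality to the kernel *)

Section spectral_additivity.
Context {R : realType} {d : measure_display} {X : measurableType d}.
Context {mu : {measure set X -> \bar R}} {E : set R -> operator mu}.
Hypothesis hE : projection_valued_measure E.
Implicit Types f g h : X -> R[i].
Implicit Types B C : set R.
Local Notation L2 := (in_Lp mu 2).
Local Notation rip := (rip mu).
Local Notation nu := (spectral_mass (E := E)).

Lemma nuU f B C : measurable B -> measurable C -> B `&` C = set0 -> L2 f ->
  nu f (B `|` C) = nu f B + nu f C.
Proof.
move=> mB mC BC Lf; have [m mE] := spectral_measure_ex hE Lf.
by apply: EFin_inj; rewrite EFinD -!mE ?measureU//; exact: measurableU.
Qed.

Lemma le_nu f B C : measurable B -> measurable C -> B `<=` C -> L2 f ->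
  nu f B <= nu f C.
Proof.
move=> mB mC BC Lf; have [m mE] := spectral_measure_ex hE Lf.
by rewrite -lee_fin -!mE// le_measure ?inE.
Qed.

Lemma nuD f g B : measurable B -> L2 f -> L2 g ->
  nu (fun x => f x + g x) B = nu f B + nu g B + 2 * rip (E B f) g.
Proof.
move=> mB Lf Lg; have LD := L2D Lf Lg.
have LEf := E_L2 hE mB Lf; have LEg := E_L2 hE mB Lg; have LED := E_L2 hE mB LD.
rewrite /nu [LHS]ripC ripDl// -!E_sym//.
rewrite [X in X + _ = _]ripC [X in _ + X = _]ripC !ripDl//.
rewrite [rip f (E B f)]ripC [rip g (E B f)]ripC [rip g (E B g)]ripC.
by rewrite -(E_sym hE mB Lf Lg); ring.
Qed.

(** Polarization: apply [nuU] to f + g, f and g, and read off the cross term through [nuD]. *)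
Lemma rip_EU f g B C : measurable B -> measurable C -> B `&` C = set0 ->
  L2 f -> L2 g -> rip (E (B `|` C) f) g = rip (E B f) g + rip (E C f) g.
Proof.
move=> mB mC BC Lf Lg; have LD := L2D Lf Lg.
have := nuU mB mC BC LD; rewrite !nuD//; last exact: measurableU.
by rewrite !(nuU mB mC BC)//; lra.
Qed.

Lemma rip_E_itv (c : nat -> R) n f g : {homo c : i j / (i <= j)%N >-> i <= j} ->
  0 <= c 0%N -> L2 f -> L2 g ->
  rip (E `]0, c n]%classic f) g = rip (E `]0, c 0%N]%classic f) g +
    \sum_(i < n) rip (E `]c i, c i.+1]%classic f) g.
Proof.
move=> cnd c0 Lf Lg; elim: n => [|n IH]; first by rewrite big_ord0 addr0.
rewrite big_ord_recr/= addrA -IH -rip_EU//.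
  by rewrite -itv_bndbnd_setU// bnd_simp ?(le_trans c0)// cnd.
apply/seteqP; split => x //=; rewrite !in_itv/= => -[/andP[_ x0] /andP[x1 _]].
by move: x0; rewrite leNgt x1.
Qed.

Lemma E_null f B : measurable B -> L2 f -> nu f B = 0 -> eqae mu (E B f) (fun=> 0).
Proof.
by move=> mB Lf nu0; apply: rip_eq0; [exact: E_L2|rewrite -nu_sqr].
Qed.

Lemma eqae_rip f g : L2 f -> L2 g -> (forall h, L2 h -> rip f h = rip g h) ->
  eqae mu f g.
Proof.
move=> Lf Lg fg; have LB := L2B Lf Lg; have : eqae mu (fun x => f x - g x) (fun=> 0).
  by apply: rip_eq0 => //; rewrite ripBl// fg// subrr.
by apply: filterS => x /eqP; rewrite subr_eq0 => /eqP.
Qed.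

Lemma E_split f B C : measurable B -> measurable C -> B `&` C = set0 ->
  L2 f -> nu f (~` (B `|` C)) = 0 -> eqae mu f (fun x => E B f x + E C f x).
Proof.
move=> mB mC BC Lf nu0; have mBC := measurableU _ _ mB mC.
have LB := E_L2 hE mB Lf; have LC := E_L2 hE mC Lf.
apply: eqae_rip => //; first exact: L2D.
move=> h Lh; rewrite ripDl// -rip_EU//.
have <- : rip (E setT f) h = rip f h.
  by apply: rip_eqae => //; [exact: E_L2|exact: pvm_setT].
have mC' := measurableC mBC.
rewrite -(setUv (B `|` C)) rip_EU//; last exact: setICr.
rewrite [X in _ + X](@rip_eqae _ _ _ _ _ (fun=> 0)) ?rip0l ?addr0//.
- exact: E_L2.
- exact: L2_0.
- exact: E_null.
Qed.

End spectral_additivity.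

(** * Spectral mass of the nonpositive half-line *)

Section kernel.
Context {R : realType} {d : measure_display} {X : measurableType d}.
Context {mu : {measure set X -> \bar R}} {E : set R -> operator mu}.
Variable A : operator mu.
Hypothesis hE : projection_valued_measure E.
Hypothesis hA : spectral_integral E id A.
Hypothesis A_ge0 : positive_op A.
Hypothesis A_dense : densely_defined A.
Implicit Types f g h : X -> R[i].
Local Notation L2 := (in_Lp mu 2).
Local Notation rip := (rip mu).
Local Notation nu := (spectral_mass (E := E)).

Let quad_ge0 u : dom A u -> 0 <= rip (A u) u.
Proof. by move=> /A_ge0; rewrite lecE Re_inner => /andP[_]. Qed.

(** Isotropic vectors of a nonnegative form lie in its kernel: <A(s u + g), s u + g> is affine in s
    when <A u, u> = 0, so staying nonnegative forces <A u, g> = 0. Density of the domain then gives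
    A u = 0. *)
Lemma quad_eq0_ker u : dom A u -> rip (A u) u = 0 -> ker A u.
Proof.
move=> du q0; split => //; have Lu := dom_L2 du; have LAu := T_L2 du.
have Au0 g : dom A g -> rip (A u) g = 0.
  move=> dg; have Lg := dom_L2 dg; have LAg := T_L2 dg.
  have P s : 0 <= 2 * s * rip (A u) g + rip (A g) g.
    have ds := dom_lin s%:C%C du dg.
    have := quad_ge0 ds; rewrite T_lin//; last exact: (dom_L2 ds).
    have Ls := dom_L2 ds.
    rewrite rip_lin// [rip (A u) _]ripC [rip (A g) _]ripC !rip_lin//.
    rewrite [rip u (A u)]ripC q0 [rip g (A u)]ripC [rip g (A g)]ripC.
    by rewrite -(T_sym hA du dg); lra.
  (* This s gives the affine function the value -1. *)
  apply: contrapT => /eqP r0; have := P (- (rip (A g) g + 1) / 2 / rip (A u) g).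
  by rewrite (_ : 2 * _ * _ = - (rip (A g) g + 1)); [lra|field].
apply: rip_eq0 => //; apply: contrapT => /eqP r0.
have rp : 0 < rip (A u) (A u) by rewrite lt0r r0 rip_ge0.
pose N := Num.sqrt (rip (A u) (A u)).
have N0 : 0 < N by rewrite sqrtr_gt0.
(* With g closer to A u than |A u|, orthogonality gives |A u|^2 = <A u - g, A u> < |A u|^2. *)
have [g dg] := A_dense LAu N0; have Lg := dom_L2 dg.
have LB := L2B LAu Lg.
rewrite cnorm2_rip// lte_fin => lt.
have := rip_CauchySchwarz LB LAu; rewrite ripBl// [rip g _]ripC (Au0 g dg) subr0.
rewrite leNgt => /negP; apply.
rewrite -[ltRHS]sqr_sqrtr ?rip_ge0// expr2 -/N ltr_pM2r//.
Qed.

(** The atom at 0 vanishes because E({0}) f lies in the kernel, to which f is orthogonal; the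
    negative part vanishes because A would be negative definite on it. *)
Lemma nu_nonpos_ortho_ker f : ortho_compl mu (ker A) f -> nu f `]-oo, 0]%classic = 0.
Proof.
move=> [Lf f_ker].
have nu0 : nu f [set 0] = 0.
  have du : dom A (E [set 0] f).
    by apply: (dom_E_bounded (K := 0) hE _ hA) => // t ->; rewrite expr0n.
  have Lu := dom_L2 du.
  have : ker A (E [set 0] f).
    apply: quad_eq0_ker => //; apply/le_anti; rewrite quad_ge0// andbT.
    rewrite -[leRHS](mul0r (rip (E [set 0] f) (E [set 0] f))).
    by apply: (quad_le (B := [set 0]) hE _ hA) => //; [exact: nu_compl|move=> t ->].
  by move=> /f_ker /(congr1 (@complex.Re R)); rewrite Re_inner/= ripC.
(* The lower end keeps E(B) f in the domain of A, and the upper end bounds the form by a strictly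
   negative multiple of |E(B) f|^2; these intervals exhaust ]-oo, 0[. *)
have nuN k : nu f `[- k.+1%:R, - k.+1%:R^-1]%classic = 0.
  set B := `[_, _]%classic.
  have mB : measurable B by exact: measurable_itv.
  have du : dom A (E B f).
    apply: (dom_E_bounded (K := k.+1%:R ^+ 2) hE _ hA) => // t.
    rewrite /B/= in_itv/= => /andP[t1 t2].
    have k0 : (0 : R) < k.+1%:R^-1 by rewrite invr_gt0.
    have t0 : t <= 0 by rewrite (le_trans t2)// oppr_le0 ltW.
    by rewrite -sqrrN ler_pXn2r ?nnegrE ?oppr_ge0// lerNl.
  have : rip (A (E B f)) (E B f) <= (- k.+1%:R^-1) * rip (E B f) (E B f).
    by apply: (quad_le (B := B) hE _ hA) => //; [exact: nu_compl|
      move=> t; rewrite /B/= in_itv/= => /andP[]].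
  move=> /(le_trans (quad_ge0 du)); rewrite mulNr oppr_ge0 pmulr_rle0 ?invr_gt0//.
  by rewrite nu_sqr// => ?; apply/le_anti; rewrite rip_ge0 andbT.
have [m mE] := spectral_measure_ex hE Lf.
have -> : `]-oo, 0 : R]%classic =
    [set 0] `|` \bigcup_k `[- k.+1%:R, - k.+1%:R^-1]%classic.
  apply/seteqP; split => [x|x] /=; rewrite ?in_itv/=.
    rewrite le_eqVlt => /orP[/eqP|x0]; [by left|right].
    have nx : 0 < - x by rewrite oppr_gt0.
    exists (maxn (Num.bound (- x)^-1) (Num.bound (- x))) => //=; rewrite in_itv/=.
    rewrite lerNl lerNr; apply/andP; split.
      by rewrite (le_trans (ltW (archi_boundP (ltW nx))))// ler_nat ltnW// ltnS leq_maxr.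
    rewrite invf_ple ?posrE// (le_trans (ltW (archi_boundP _)))// ?invr_ge0 ?ltW//.
    by rewrite ltr_nat ltnS leq_maxl.
  case=> [->//|[k _]] /=; rewrite in_itv/= => /andP[_ /le_trans]; apply.
  by rewrite oppr_le0 invr_ge0.
apply: EFin_inj; rewrite -mE; last first.
  by apply: measurableU => //; exact: bigcup_measurable.
apply/negligibleP; first by apply: measurableU => //; exact: bigcup_measurable.
apply: negligibleU; first by apply/negligibleP => //; apply: (etrans (mE _ _)); rewrite ?nu0.
by apply: negligible_bigcup => k; apply/negligibleP => //; apply: (etrans (mE _ _)); rewrite ?nuN.
Qed.

End kernel.
(** * Sup norm bounds by duality *)

Section duality.
Context {R : realType} {d : measure_display} {X : measurableType d}.
Variable mu : {measure set X -> \bar R}.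
Implicit Types f g h : X -> R[i].
Local Notation L2 := (in_Lp mu 2).
Local Notation rip := (rip mu).

Lemma cmodZ (r : R) (u : R[i]) : 0 <= r -> cmod (r%:C%C * u) = r * cmod u.
Proof.
move=> r0; rewrite /cmod ComplexField.Normc.normcM; congr (_ * _).
by rewrite /= expr0n/= addr0 sqrtr_sqr ger0_norm.
Qed.

Lemma cnorm1E f : cnorm mu 1 f = (\int[mu]_x (cmod (f x))%:E)%E.
Proof.
rewrite /cnorm Lnorm1; apply: eq_integral => x _.
by rewrite abse_EFin ger0_norm ?cmod_ge0.
Qed.

Lemma norm_dot_le f g x : `|dot f g x| <= cmod (f x) * cmod (g x).
Proof.
rewrite -[leRHS]ger0_norm ?mulr_ge0 ?cmod_ge0// -!sqrtr_sqr ler_wsqrtr//.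
rewrite exprMn !sqr_cmod /dot.
set a := complex.Re _; set b := complex.Re _; set a' := complex.Im _; set b' := complex.Im _.
rewrite -subr_ge0 (_ : _ - _ = (a * b' - a' * b) ^+ 2); last by ring.
exact: sqr_ge0.
Qed.

(* Test the hypothesis on g = f / N on the level set, N being the integral of
   |f| there. *)
Lemma negligible_level f (M e : R) : 0 < e -> L2 f ->
  (forall g, in_Lp mu 1 g -> L2 g -> (cnorm mu 1 g <= 1)%E -> rip f g <= M) ->
  mu.-negligible [set x | M + e < cmod (f x)].
Proof.
move=> e0 Lf fM; set S := [set x | _].
have M0 : 0 <= M.
  rewrite -(rip0l mu f) ripC; apply: fM; last 1 first.
  - rewrite cnorm1E integral0_eq// => x _.
    by rewrite cmodE/= expr0n/= addr0 sqrtr0.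
  - split; try exact: measurable_cst.
    rewrite cnorm1E integral0_eq ?ltry// => x _.
    by rewrite cmodE/= expr0n/= addr0 sqrtr0.
  - exact: L2_0.
have Me0 : 0 < M + e by lra.
have [mr mi _] := Lf; have mc := measurable_cmod mr mi.
have mS : measurable S.
  rewrite (_ : S = setT `&` (fun x => cmod (f x)) @^-1` `]M + e, +oo[%classic).
    by apply: mc => //.
  by apply/seteqP; split => x /=; rewrite in_itv/= andbT ?andTb // => -[].
pose w x := (\1_S x)%:C%C * f x.
have S01 x : \1_S x = 0 :> R \/ \1_S x = 1 :> R.
  by rewrite indicE; case: (x \in S); [right|left].
have dotww x : dot w w x = \1_S x * dot f f x.
  by rewrite /dot /w !cE/=; case: (S01 x) => ->; ring.
have Lw : L2 w.
  apply/L2P; split.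
  - rewrite (_ : _ \o _ = (fun x => \1_S x * complex.Re (f x))).
      by apply: measurable_funM => //; exact: measurable_indic.
    by apply/funext => x /=; rewrite /w !cE/= mul0r subr0.
  - rewrite (_ : _ \o _ = (fun x => \1_S x * complex.Im (f x))).
      by apply: measurable_funM => //; exact: measurable_indic.
    by apply/funext => x /=; rewrite /w !cE/= mul0r addr0.
  have /L2P[_ _] := Lf; apply: le_lt_trans; apply: ge0_le_integral => //.
  - by move=> x _; rewrite lee_fin dot_ge0.
  - apply/measurable_EFinP; rewrite (funext dotww).
    by apply: measurable_funM; [exact: measurable_indic|exact: measurable_dot].
  - by apply/measurable_EFinP; exact: measurable_dot.
  move=> x _; rewrite dotww lee_fin.
  by case: (S01 x) => ->; rewrite ?mul1r// mul0r dot_ge0.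
have dotfw x : dot f w x = \1_S x * cmod (f x) ^+ 2.
  by rewrite sqr_cmod /dot /w !cE/=; ring.
have cw x : cmod (w x) = \1_S x * cmod (f x).
  by apply: cmodZ; case: (S01 x) => ->.
have mw : measurable_fun setT (fun x => cmod (w x)).
  by have [mrw miw _] := Lw; exact: measurable_cmod.
have le_w x : (M + e) * cmod (w x) <= dot f w x.
  rewrite cw dotfw indicE; case: (boolP (x \in S)) => [/set_mem/= Sx|_];
    last by rewrite !mul0r mulr0.
  rewrite !mul1r expr2 ler_wpM2r ?cmod_ge0// ltW//.
(* On the level set |f| > M + e > 0, so |w| <= [dot f w] / (M + e): the truncation w is in L^1
   although f is only in L^2. *)
have iw : mu.-integrable setT (fun x => (cmod (w x))%:E).
  apply: (le_integrable measurableT _ _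
    (integrableZl measurableT (M + e)^-1 (dot_integrable Lf Lw))).
    exact/measurable_EFinP.
  move=> x _; rewrite -EFinM !abse_EFin lee_fin ger0_norm ?cmod_ge0//.
  by rewrite (le_trans _ (ler_norm _))// ler_pdivlMl.
pose N := \int[mu]_x cmod (w x).
have NE : N%:E = (\int[mu]_x (cmod (w x))%:E)%E.
  by rewrite /N /Rintegral fineK//; exact: integrable_fin_num.
have N0 : 0 <= N by apply: Rintegral_ge0 => x _; exact: cmod_ge0.
have NI : (M + e) * N <= rip f w.
  rewrite /N -RintegralZl//; apply: le_Rintegral => //.
  - exact: (integrableZl measurableT (M + e) iw).
  - exact: dot_integrable.
have N00 : N = 0.
  (* Otherwise w / N is an admissible test function, and [NI] yields M + e <= M. *)
  apply: contrapT => /eqP Nn0; have Np : 0 < N by rewrite lt0r Nn0.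
  have iN0 : 0 <= N^-1 by rewrite invr_ge0.
  have Lg : L2 (fun x => (N^-1)%:C%C * w x) by exact: L2Z.
  have cg : cnorm mu 1 (fun x => (N^-1)%:C%C * w x) = 1%E.
    rewrite cnorm1E; under eq_integral do rewrite cmodZ// EFinM.
    rewrite ge0_integralZl_EFin//.
    - by rewrite -NE -EFinM mulVf.
    - by move=> x _; rewrite lee_fin cmod_ge0.
    - exact/measurable_EFinP.
  have : rip f (fun x => (N^-1)%:C%C * w x) <= M.
    apply: fM => //; last by rewrite cg.
    by have [? ? _] := Lg; split => //; rewrite cg ltry.
  rewrite ripC ripZl// ripC -(ler_pM2l Np) mulrA mulfV// mul1r => H.
  have : e * N <= 0 by lra.
  by rewrite pmulr_rle0// leNgt Np.
apply/negligibleP => //; apply/eqP; rewrite -measure_le0.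
have : ((M + e)%:E * mu S <= 0)%E.
  rewrite (_ : 0%E = N%:E); last by rewrite N00.
  rewrite NE -(setIT S) -integral_indic// -ge0_integralZl_EFin//;
    [|by apply/measurable_EFinP; exact: measurable_indic|exact: ltW].
  apply: ge0_le_integral => //.
  - by move=> x _; rewrite -EFinM lee_fin mulr_ge0// ltW.
  - by apply/measurable_EFinP; apply: measurable_funM => //; exact: measurable_indic.
  - exact/measurable_EFinP.
  move=> x _; rewrite -EFinM lee_fin cw indicE.
  case: (boolP (x \in S)) => [/set_mem/= Sx|_]; rewrite ?mulr0 ?mul0r// mulr1 mul1r ltW//.
by rewrite pmule_rle0// lte_fin.
Qed.

Lemma ae_cmod_le f (M : R) : L2 f ->
  (forall g, in_Lp mu 1 g -> L2 g -> (cnorm mu 1 g <= 1)%E -> rip f g <= M) ->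
  {ae mu, forall x, cmod (f x) <= M}.
Proof.
move=> Lf fM.
have : mu.-negligible (\bigcup_k [set x | M + k.+1%:R^-1 < cmod (f x)]).
  by apply: negligible_bigcup => k; apply: negligible_level.
apply: negligibleS => x /= /negP; rewrite -ltNge => Mx.
have d0 : 0 < cmod (f x) - M by rewrite subr_gt0.
exists (Num.bound (cmod (f x) - M)^-1) => //=.
rewrite -ltrBrDl invf_plt ?posrE//.
by rewrite (lt_trans (archi_boundP _))// ?invr_ge0 ?ltW// ltr_nat.
Qed.

Lemma rip_norm_1oo (P : (X -> R[i]) -> (X -> R[i])) g :
  L2 (P g) -> (norm_1oo mu P < +oo)%E -> in_Lp mu 1 g -> L2 g ->
  (cnorm mu 1 g <= 1)%E -> rip (P g) g <= fine (norm_1oo mu P).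
Proof.
move=> LPg Pfin L1g Lg g1; set K := fine _.
have K0 : 0 <= K by apply: fine_ge0; exact: norm_1oo_ge0.
have PK : (cnorm mu +oo%E (P g) <= K%:E)%E.
  rewrite fineK ?ge0_fin_numE ?norm_1oo_ge0//.
  by apply: ereal_sup_ubound; exists g.
have aeK : {ae mu, forall x, cmod (P g x) <= K}.
  move: PK; rewrite /cnorm Lnorm.unlock.
  (* The norm at +oo is an essential supremum only when [mu] is nonzero, and 0 otherwise; in the
     latter case everything is negligible. *)
  case: ifPn => [mu0 /ess_supP|].
    by apply: filterS => x; rewrite /= lee_fin ger0_norm ?cmod_ge0.
  rewrite -leNgt => mu0 _; apply: (negligibleS (@subsetT _ _)).
  by apply/negligibleP => //; apply/eqP; rewrite -measure_le0.
have [mr mi _] := LPg; have [mrg mig _] := Lg.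
rewrite (le_trans (ler_norm _))// -lee_fin.
rewrite EFin_normr_Rintegral//; last exact: dot_integrable.
apply: (le_trans (le_abse_integral _ _ _)) => //.
  by apply/measurable_EFinP; exact: measurable_dot.
apply: (@le_trans _ _ (\int[mu]_x (K%:E * (cmod (g x))%:E))%E).
  apply: ae_ge0_le_integral => //.
  - by apply: measurableT_comp => //; apply/measurable_EFinP; exact: measurable_dot.
  - by move=> x _; rewrite -EFinM lee_fin mulr_ge0// cmod_ge0.
  - by apply/measurable_EFinP; apply: measurable_funM => //; exact: measurable_cmod.
  apply: filterS aeK => x xK _; rewrite -EFinM abse_EFin lee_fin.
  by rewrite (le_trans (norm_dot_le _ _ _))// ler_wpM2r// cmod_ge0.
rewrite ge0_integralZl_EFin//.
- by rewrite -cnorm1E -[leRHS]mule1 lee_wpmul2l// lee_fin.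
- by move=> x _; rewrite lee_fin cmod_ge0.
- by apply/measurable_EFinP; exact: measurable_cmod.
Qed.

End duality.

(** * The sup norm bound for the low spectral part *)

Section sup_bound.
Context {R : realType} {d : measure_display} {X : measurableType d}.
Context {mu : {measure set X -> \bar R}} {E : set R -> operator mu}.
Variable T : operator mu.
Hypothesis hE : projection_valued_measure E.
Hypothesis hT : spectral_integral E Num.sqrt T.
Implicit Types f g h : X -> R[i].
Local Notation L2 := (in_Lp mu 2).
Local Notation rip := (rip mu).
Local Notation nu := (spectral_mass (E := E)).
Local Notation F := (spectral_density E).
Local Notation Fr := (right_limit (spectral_density_ge0 E)).
Local Notation G := (stieltjes_inv (spectral_density_ge0 E)).
Hypothesis F_fin : forall l : R, 0 < l -> (F l < +oo)%E.
Hypothesis G_fin : forall l : R, 0 < l -> (G l < +oo)%E.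

Lemma fine_G_le a b : 0 < b -> a <= b -> fine (G a) <= fine (G b).
Proof.
move=> b0 ab; have Gb := G_fin b0; have Gab := stieltjes_inv_le (spectral_density_ge0 E) ab.
apply: fine_le => //; rewrite ge0_fin_numE ?stieltjes_inv_ge0//.
exact: le_lt_trans Gab Gb.
Qed.

Lemma G_fineK a : 0 < a -> (fine (G a))%:E = G a.
Proof. by move=> a0; rewrite fineK// ge0_fin_numE ?stieltjes_inv_ge0// G_fin. Qed.

Lemma fine_G_ge a : 0 < a -> a^-1 * Fr a <= fine (G a).
Proof. by move=> a0; rewrite -lee_fin G_fineK// stieltjes_inv_ge. Qed.

Lemma fine_G_step a b : 0 < a -> a <= b ->
  fine (G a) + b^-1 * (Fr b - Fr a) <= fine (G b).
Proof.
move=> a0 ab; have b0 := lt_le_trans a0 ab.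
by rewrite -lee_fin EFinD !G_fineK// stieltjes_inv_step.
Qed.

Section dual_vector.
Variable g : X -> R[i].
Hypotheses (L1g : in_Lp mu 1 g) (Lg : L2 g) (g1 : (cnorm mu 1 g <= 1)%E).

(** The mass nu of ]0, u] is <E(]0, u]) g, g>, at most F(u) |g|_1^2 by pairing L^oo with L^1; taking
    all u > l gives the right limit. *)
Lemma nu_le_Fr l : 0 < l -> nu g `]0, l]%classic <= Fr l.
Proof.
move=> l0; apply: right_limit_ge; first exact: ltW.
move=> u lu; have u0 : 0 < u by exact: lt_trans lu.
apply: (@le_trans _ _ (nu g `]0, u]%classic)).
  apply: le_nu => // x /=; rewrite !in_itv/= => /andP[-> xl].
  by rewrite (le_trans xl) ?ltW.
by apply: rip_norm_1oo => //; [exact: E_L2|exact: F_fin].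
Qed.

(* Abel summation: only the measures of the sets ]0, c i] are controlled by F,
   and the weights 1 / c i are nonincreasing. *)
Lemma weighted_nu_sum (c : nat -> R) (th : R) n : 1 <= th -> (forall i, 0 < c i) ->
  {homo c : i j / (i <= j)%N >-> i <= j} -> (forall i, c i.+1 <= th * c i) ->
  \sum_(i < n) (c i)^-1 * nu g `]c i, c i.+1]%classic <= th * fine (G (c n)).
Proof.
move=> th1 c0 cnd cth; pose m i := nu g `]0, c i]%classic.
have m_le i : m i <= Fr (c i) by exact: nu_le_Fr.
have mS i : nu g `]c i, c i.+1]%classic = m i.+1 - m i.
  rewrite /m (_ : `]0, c i.+1]%classic =
    `]0, c i]%classic `|` `]c i, c i.+1]%classic); last first.
    by rewrite -itv_bndbnd_setU// bnd_simp ?(ltW (c0 _))// cnd.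
  rewrite (nuU hE) //; first by ring.
  apply/seteqP; split => x //=; rewrite !in_itv/= => -[/andP[_ x0] /andP[x1 _]].
  by move: x0; rewrite leNgt x1.
have th0 : 0 < th by lra.
(* The extra nonnegative summand is the boundary term of the Abel summation; it makes the induction
   close. *)
suff : \sum_(i < n) (c i)^-1 * nu g `]c i, c i.+1]%classic +
    (c n)^-1 * (Fr (c n) - m n) <= th * fine (G (c n)).
  apply: le_trans; rewrite lerDl mulr_ge0// ?subr_ge0// invr_ge0 ltW//.
elim: n => [|n IH].
  rewrite big_ord0 add0r; have G0 := fine_G_ge (c0 0%N).
  have G00 : 0 <= fine (G (c 0%N)) by apply: fine_ge0; exact: stieltjes_inv_ge0.
  apply: (@le_trans _ _ (fine (G (c 0%N)))).
    apply: le_trans G0; rewrite ler_wpM2l ?invr_ge0 ?(ltW (c0 _))// gerBl.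
    exact: nu_ge0.
  by rewrite ler_peMl.
rewrite big_ord_recr/= mS.
have H := fine_G_step (c0 n) (cnd _ _ (leqnSn n)).
have iM : (c n.+1)^-1 <= (c n)^-1 by rewrite lef_pV2 ?posrE// cnd.
have iT : (c n)^-1 <= th * (c n.+1)^-1.
  by rewrite -ler_pdivrMl// -invfM lef_pV2 ?posrE ?mulr_gt0// mulrC.
have FS : 0 <= Fr (c n.+1) - Fr (c n) by rewrite subr_ge0 le_right_limit// cnd.
have FmS : 0 <= Fr (c n.+1) - m n.+1 by rewrite subr_ge0.
(* [iM] handles the new boundary term. [iT] moves the increment of F from the weight at the left end
   to that at the right end, where [fine_G_step] applies; this is the cost th. *)
have := ler_wpM2r FmS iM; have := ler_wpM2r FS iT; have := ler_wpM2l (ltW th0) H; move: IH.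
set S := \sum_(i < n) _; set p := (c n)^-1; set q := (c n.+1)^-1; lra.
Qed.

(* The interval ]0, l] is cut at the points c i = l s^(2 (i - n)); the pieces are
   handled by Cauchy-Schwarz with weights c i and 1 / c i. *)
Lemma rip_E_geometric f l s n : dom T f -> 0 < l -> 1 < s ->
  rip (E `]0, l]%classic f) g <=
    Num.sqrt (rip f f) * Num.sqrt (l * fine (G l)) * s^-1 ^+ n +
    s * Num.sqrt (fine (G l) * rip (T f) (T f)).
Proof.
move=> df l0 s1; have Lf := dom_L2 df; have s0 : 0 < s by lra.
have Gl0 : 0 <= fine (G l) by apply: fine_ge0; exact: stieltjes_inv_ge0.
pose c i := l * (s ^+ 2) ^+ i / (s ^+ 2) ^+ n.
have s20 : 0 < s ^+ 2 by rewrite exprn_gt0.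
have s21 : 1 <= s ^+ 2 by rewrite exprn_ege1// ltW.
have c0 i : 0 < c i by rewrite divr_gt0// ?mulr_gt0// exprn_gt0.
have cS i : c i.+1 = s ^+ 2 * c i by rewrite /c exprS; ring.
have cnd : {homo c : i j / (i <= j)%N >-> i <= j}.
  apply/nondecreasing_seqP => i.
  by rewrite cS ler_peMl// ltW.
have cn : c n = l by rewrite /c mulfK// gt_eqF// exprn_gt0.
rewrite -{1}cn (rip_E_itv hE)//; last exact: ltW.
apply: lerD.
  (* The uncut piece near 0 has no lower bound on u: it is bounded by |f| times the square root of
     F(c 0) <= c 0 * G(l), small since c 0 = l s^(-2n). *)
  have m0 : measurable `]0, c 0%N]%classic by exact: measurable_itv.
  have LE := E_L2 hE m0 Lg.
  rewrite (E_sym hE)//; apply: le_trans (rip_CauchySchwarz Lf LE) _.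
  rewrite -mulrA ler_wpM2l ?sqrtr_ge0// -(nu_sqr hE)//.
  have -> : Num.sqrt (l * fine (G l)) * s^-1 ^+ n = Num.sqrt (c 0%N * fine (G l)).
    rewrite /c expr0 mulr1 mulrAC [RHS]sqrtrM; last by rewrite mulr_ge0 ?(ltW l0).
    by rewrite -exprM mulnC exprM -exprVn sqrtr_sqr ger0_norm -?exprVn// exprn_ge0// invr_ge0 ltW.
  rewrite ler_wsqrtr//; apply: le_trans (nu_le_Fr (c0 0%N)) _.
  rewrite -ler_pdivrMl//; apply: le_trans (fine_G_ge (c0 0%N)) _.
  by apply: fine_G_le => //; rewrite -cn cnd.
pose B (i : 'I_n) := `]c i, c i.+1]%classic.
have mB i : measurable (B i) by exact: measurable_itv.
have tB i j : i != j -> B i `&` B j = set0.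
  wlog ij : i j / (i < j)%N => [W ij|_].
    by case: (ltngtP i j) => [/W|/W|/val_inj/eqP]; rewrite ?(negPf ij)//;
      [apply|rewrite setIC; apply; rewrite eq_sym].
  apply/seteqP; split => x //=; rewrite /B/= !in_itv/= => -[/andP[_ x1] /andP[x2 _]].
  have := le_lt_trans x1 (le_lt_trans (cnd _ _ ij) x2).
  by rewrite ltxx.
(* The left endpoint is used so that a i <= t^(1/2) on the piece, as [quad_sum_le] requires. The
   weights a i and 1 / a i cancel in the product. *)
pose a (i : 'I_n) := Num.sqrt (c i).
have a0 i : 0 < a i by rewrite sqrtr_gt0.
have a2 i : a i ^+ 2 = c i by rewrite sqr_sqrtr// ltW.
have -> : \sum_(i < n) rip (E `]c i, c i.+1]%classic f) g =
    rip (fun x => \sum_(i < n) (a i)%:C%C * E (B i) f x)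
        (fun x => \sum_(i < n) ((a i)^-1)%:C%C * E (B i) g x).
  rewrite (rip_E_sum hE)//; apply: eq_bigr => i _.
  by rewrite mulfV ?mul1r// gt_eqF.
have Lsum (b : 'I_n -> R) h : L2 h -> L2 (fun x => \sum_(i < n) (b i)%:C%C * E (B i) h x).
  by move=> Lh; apply: L2_sum => i; apply: L2Z; exact: E_L2.
apply: le_trans (rip_CauchySchwarz (Lsum _ _ Lf) (Lsum _ _ Lg)) _.
have -> : s * Num.sqrt (fine (G l) * rip (T f) (T f)) =
    Num.sqrt (rip (T f) (T f)) * Num.sqrt (s ^+ 2 * fine (G l)).
  rewrite sqrtrM// [Num.sqrt (s ^+ 2 * _)]sqrtrM ?sqr_ge0//.
  by rewrite sqrtr_sqr ger0_norm; [ring|exact: ltW].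
rewrite !(rip_E_sum hE)//; apply: ler_pM; rewrite ?sqrtr_ge0// ler_wsqrtr//.
  apply: le_trans (quad_sum_le hE _ hT (B := B) (a := a) df mB tB _ _).
  - by apply: ler_sum => i _; rewrite expr2.
  - by apply: continuous_measurable_fun; exact: sqrt_continuous.
  - by move=> i; exact: ltW.
  - move=> i t; rewrite /B/= in_itv/= => /andP[ct _].
    by rewrite ler_wsqrtr// ltW.
have cS_le i : c i.+1 <= s ^+ 2 * c i by rewrite cS.
have := weighted_nu_sum n s21 c0 cnd cS_le; rewrite cn; apply: le_trans.
by apply: ler_sum => i _; rewrite -invfM -expr2 a2.
Qed.

Lemma rip_E_le f l : dom T f -> 0 < l ->
  rip (E `]0, l]%classic f) g <= Num.sqrt (fine (G l) * rip (T f) (T f)).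
Proof.
move=> df l0; set L := Num.sqrt _; have L0 : 0 <= L by exact: sqrtr_ge0.
apply/ler_addgt0Pr => e e0.
(* Chosen so that (s - 1) L <= e / 2, with L + 1 avoiding a zero denominator; the remaining e / 2
   absorbs the geometric term for large n. *)
pose s := 1 + e / (2 * (L + 1)).
have De : 0 < e / (2 * (L + 1)) by rewrite divr_gt0// mulr_gt0// ltr_wpDl.
have s1 : 1 < s by rewrite /s ltrDl.
have sL : s * L <= L + e / 2.
  rewrite /s mulrDl mul1r lerD2l mulrAC ler_pdivrMr ?mulr_gt0 ?ltr_wpDl//; nra.
pose K := Num.sqrt (rip f f) * Num.sqrt (l * fine (G l)).
have : (fun n => K * s^-1 ^+ n) @ \oo --> (K * 0 : R).
  apply: cvgMr; apply: cvg_expr.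
  by rewrite ger0_norm ?invr_ge0; [rewrite invf_lt1//|]; lra.
rewrite mulr0 => /cvgrPdist_lt /(_ (e / 2)); rewrite divr_gt0// => /(_ isT).
move=> [N _ /(_ N (leqnn N))] /=; rewrite sub0r normrN => KN.
apply: le_trans (rip_E_geometric N df l0 s1) _; rewrite -/L -/K.
have := ler_norm (K * s^-1 ^+ N); lra.
Qed.

End dual_vector.

Lemma ae_E_le f l : dom T f -> 0 < l -> {ae mu, forall x,
  cmod (E `]0, l]%classic f x) <= Num.sqrt (fine (G l) * rip (T f) (T f))}.
Proof.
move=> df l0; apply: ae_cmod_le; first by apply: E_L2 => //; exact: dom_L2 df.
by move=> g L1g Lg g1; exact: rip_E_le.
Qed.

End sup_bound.
(** * Integration over the levels *)

Section rc_inverse_approximation.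
Context {R : realType}.
Variable G : R -> \bar R.
Hypothesis G_le : forall a b, a <= b -> (G a <= G b)%E.
Hypothesis G0 : G 0 = 0%E.

(** A Riemann sum, with mesh 1/N on ]0, M/N], of the indicator of the levels l with G(l) <= y. For
    monotone G these form an initial interval whose length is the right continuous inverse. *)
Definition level_count (N : nat) (y : R) (M : nat) : R :=
  \sum_(i < M) N%:R^-1 * (G (i.+1%:R / N%:R) <= y%:E)%E%:R.

Lemma rc_inverse_ge (y l : R) : 0 <= l -> (G l <= y%:E)%E -> (l%:E <= rc_inverse G y)%E.
Proof. by move=> l0 Gl; apply: ereal_sup_ubound; exists l. Qed.

Lemma level_count_le N y M : 0 <= y -> ((level_count N y M)%:E <= rc_inverse G y)%E.
Proof.
move=> y0; have up n : level_count N y n <= n%:R / N%:R.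
  elim: n => [|n IH]; first by rewrite /level_count big_ord0 mul0r.
  rewrite /level_count big_ord_recr/= -[leRHS]/(n.+1%:R / N%:R) -natr1 mulrDl mul1r lerD//.
  by rewrite ler_piMr ?invr_ge0//; case: (_ <= _)%E.
elim: M => [|M IH].
  by rewrite /level_count big_ord0; apply: rc_inverse_ge; rewrite ?G0.
case: (boolP (G (M.+1%:R / N%:R) <= y%:E)%E) => [GM|GM].
  apply: le_trans (rc_inverse_ge _ GM); first by rewrite lee_fin.
  by rewrite divr_ge0.
by rewrite /level_count big_ord_recr/= (negbTE GM) mulr0 addr0.
Qed.

Lemma level_count_ge N y l M : (0 < N)%N -> 0 <= l -> (G l <= y%:E)%E ->
  l <= M%:R / N%:R -> l - N%:R^-1 <= level_count N y M.
Proof.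
move=> N0 l0 Gl lM; have Np : (0 : R) < N%:R by rewrite ltr0n.
have eqn k : k%:R / N%:R <= l -> level_count N y k = k%:R / N%:R.
  elim: k => [|k IH] kl; first by rewrite /level_count big_ord0 mul0r.
  rewrite /level_count big_ord_recr/= (le_trans _ Gl) ?G_le// mulr1.
  rewrite -/(level_count N y k) IH -?[k.+1%:R]natr1 ?mulrDl ?mul1r//.
  by apply: le_trans kl; rewrite ler_pM2r ?invr_gt0// ler_nat.
have mono k n : (k <= n)%N -> level_count N y k <= level_count N y n.
  elim: n => [|n IH]; first by rewrite leqn0 => /eqP->.
  rewrite leq_eqVlt => /orP[/eqP->//|]; rewrite ltnS => /IH/le_trans; apply.
  by rewrite /level_count big_ord_recr/= lerDl mulr_ge0 ?invr_ge0.
have lN0 : 0 <= l * N%:R by rewrite mulr_ge0.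
have /andP[k1 k2] := truncn_itv lN0; set k := Num.truncn _ in k1 k2.
have kM : (k <= M)%N.
  by rewrite -(ler_nat R) (le_trans k1)// -ler_pdivlMr.
apply: le_trans (mono _ _ kM); rewrite eqn ?ler_pdivrMr//.
by rewrite lerBlDr -[X in _ + X]mul1r -mulrDl natr1 ler_pdivlMr// ltW.
Qed.

(** Taking M = N^2 lets the mesh 1/N shrink while the window ]0, N] fills the half-line, which
    covers an infinite inverse as well. *)
Lemma cvg_level_count y : 0 <= y ->
  (level_count n.+1 y (n.+1 * n.+1))%:E @[n --> \oo] --> rc_inverse G y.
Proof.
move=> y0; have rc0 : (0 <= rc_inverse G y)%E by apply: rc_inverse_ge; rewrite ?G0.
have near_gt (A : R) : (A%:E < rc_inverse G y)%E ->
    \forall n \near \oo, A <= level_count n.+1 y (n.+1 * n.+1).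
  move=> /ereal_sup_gt[_ [l [l0 Gl] <-]]; rewrite lte_fin => Al.
  near=> n; apply: (@le_trans _ _ (l - n.+1%:R^-1)); last first.
    apply: level_count_ge => //; rewrite natrM mulfK ?pnatr_eq0//.
    by rewrite (@le_trans _ _ n%:R) ?ler_nat//; near: n; exact: nbhs_infty_ger.
  rewrite lerBrDl addrC -lerBrDl ltW//.
  by near: n; apply: near_infty_natSinv_lt (PosNum _); rewrite subr_gt0.
case: (rc_inverse G y) rc0 (fun N M => level_count_le N M y0) near_gt => [r| |//] _ le_r near_gt.
  apply: cvg_EFin; first by near=> n.
  apply/cvgrPdist_le => e e0.
  have re : ((r - e)%:E < r%:E)%E by rewrite lte_fin; lra.
  apply: filterS (near_gt _ re) => n /= H.
  have := le_r n.+1 (n.+1 * n.+1)%N; rewrite lee_fin => H'.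
  by rewrite ger0_norm ?subr_ge0//; lra.
apply/cvgeyPge => A; apply: filterS (near_gt A (ltry _)) => n.
by rewrite lee_fin.
Unshelve. all: by end_near. Qed.

End rc_inverse_approximation.

Section layer_cake.
Context {R : realType} {d : measure_display} {X : measurableType d}.
Variable mu : {measure set X -> \bar R}.
Variable G : R -> \bar R.
Hypothesis G_le : forall a b, a <= b -> (G a <= G b)%E.
Hypothesis G0 : G 0 = 0%E.

(* Riemann sums and Fatou's lemma stand in for Fubini's theorem, as [mu] need
   not be sigma-finite. *)
Lemma integral_rc_inverse_le (y : X -> R) (t : R -> R) :
  measurable_fun setT y -> (forall x, 0 <= y x) ->
  (forall l, 0 < l -> (\int[mu]_x (y x * (G l <= (y x)%:E)%E%:R)%:E <= (t l)%:E)%E) ->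
  (forall N M, (0 < N)%N -> \sum_(i < M) N%:R^-1 * t (i.+1%:R / N%:R) <= 1) ->
  (\int[mu]_x ((y x)%:E * rc_inverse G (y x)) <= 1)%E.
Proof.
move=> my y0 yt t1.
pose h n x := ((y x)%:E * (level_count G n.+1 (y x) (n.+1 * n.+1))%:E)%E.
have hE n x : h n x = (\sum_(i < n.+1 * n.+1) (n.+1%:R^-1)%:E *
    (y x * (G (i.+1%:R / n.+1%:R)%R <= (y x)%:E)%E%:R)%:E)%E.
  rewrite /h -EFinM /level_count mulr_sumr -sumEFin; apply: eq_bigr => i _.
  by rewrite -EFinM mulrCA.
have mlev l : measurable_fun setT (fun x => (y x * (G l <= (y x)%:E)%E%:R)%:E).
  apply/measurable_EFinP; apply: measurable_funM => //.
  rewrite (_ : (fun x => _) = \1_[set x | (G l <= (y x)%:E)%E]).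
    apply: measurable_indic; rewrite -[X in measurable X]setTI.
    by apply: emeasurable_fun_c_infty => //; exact/measurable_EFinP.
  by apply/funext => x; rewrite indicE mem_setE.
have lev0 l x : (0 <= (y x * (G l <= (y x)%:E)%E%:R)%:E)%E by rewrite lee_fin mulr_ge0.
have h0 n x : (0 <= h n x)%E.
  by rewrite hE; apply: sume_ge0 => i _; rewrite mule_ge0// lee_fin invr_ge0.
have mh n : measurable_fun setT (h n).
  rewrite (funext (hE n)); apply: emeasurable_sum => i _.
  by exact: (measurable_funeM _ (mlev _)).
have ch x : h n x @[n --> \oo] --> ((y x)%:E * rc_inverse G (y x))%E.
  by apply: cvgeZl => //; exact: cvg_level_count.
have Ih n : (\int[mu]_x h n x <= 1)%E.
  under eq_integral do rewrite hE.
  rewrite ge0_integral_sum//.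
  - apply: (@le_trans _ _
      (\sum_(i < n.+1 * n.+1) (n.+1%:R^-1)%:E * (t (i.+1%:R / n.+1%:R))%:E)%E).
      apply: lee_sum => i _; rewrite ge0_integralZl_EFin ?invr_ge0//.
      by rewrite lee_wpmul2l ?lee_fin ?invr_ge0// yt// divr_gt0.
    under eq_bigr do rewrite -EFinM.
    by rewrite sumEFin lee_fin t1.
  - by move=> i; exact: (measurable_funeM _ (mlev _)).
  - by move=> i x _; rewrite mule_ge0// lee_fin invr_ge0.
have -> : (\int[mu]_x ((y x)%:E * rc_inverse G (y x)) =
    \int[mu]_x limn_einf (h ^~ x))%E.
  by apply: eq_integral => x _; rewrite (cvg_limn_einf_sup (ch x)).1.
apply: le_trans (fatou mu measurableT mh (fun n x _ => h0 n x)) _.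
rewrite limn_einf_lim; apply: lime_le; first exact: is_cvg_einfs.
apply: nearW => n; apply: le_trans (Ih n).
by apply: ereal_inf_lbound; exists n => /=.
Qed.

End layer_cake.

(** * Spectral tails and the energy *)

Section energy_bounds.
Context {R : realType} {d : measure_display} {X : measurableType d}.
Context {mu : {measure set X -> \bar R}} {E : set R -> operator mu}.
Variable T : operator mu.
Hypothesis hE : projection_valued_measure E.
Hypothesis hT : spectral_integral E Num.sqrt T.
Implicit Types f g h : X -> R[i].
Local Notation L2 := (in_Lp mu 2).
Local Notation rip := (rip mu).
Local Notation nu := (spectral_mass (E := E)).

(** Discrete form of the layer-cake formula for the integral of t against the spectral measure: an
    Abel summation turns the tail sum into a lower sum of t, to which [quad_sum_le] applies with the
    square root. *)
Lemma tail_sum_le f N M : dom T f -> (0 < N)%N ->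
  \sum_(i < M) N%:R^-1 * nu f `]i.+1%:R / N%:R, +oo[%classic <= rip (T f) (T f).
Proof.
move=> df N0; have Lf := dom_L2 df; have Np : (0 : R) < N%:R by rewrite ltr0n.
pose c i : R := i%:R / N%:R.
have cS i : c i.+1 = c i + N%:R^-1 by rewrite /c -natr1 mulrDl mul1r.
have cnd : {homo c : i j / (i <= j)%N >-> i <= j}.
  by move=> i j ij; rewrite ler_pM2r ?invr_gt0// ler_nat.
have c_ge0 i : 0 <= c i by rewrite divr_ge0.
have abel n : \sum_(i < n) N%:R^-1 * nu f `]c i.+1, +oo[%classic =
    \sum_(i < n) c i * nu f `]c i, c i.+1]%classic + c n * nu f `]c n, +oo[%classic.
  elim: n => [|n IH]; first by rewrite !big_ord0 /c mul0r mul0r addr0.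
  rewrite !big_ord_recr/= IH.
  rewrite (_ : `]c n, +oo[%classic =
    `]c n, c n.+1]%classic `|` `]c n.+1, +oo[%classic); last first.
    by rewrite -itv_bndbnd_setU// bnd_simp cnd.
  rewrite (nuU hE)//.
    by rewrite cS; ring.
  apply/seteqP; split => x //=; rewrite !in_itv/= => -[/andP[_ x0] /andP[x1 _]].
  by move: x0; rewrite leNgt x1.
rewrite (abel M).
(* The additional last piece is the unbounded tail; it carries the boundary term of [abel]. *)
pose B (i : 'I_M.+1) := if (i < M)%N then `]c i, c i.+1]%classic else `]c i, +oo[%classic.
have B_gt i t : B i t -> c i < t.
  by rewrite /B; case: ifP => _ /=; rewrite in_itv/= => /andP[].
have B_le (i : 'I_M.+1) t : (i < M)%N -> B i t -> t <= c i.+1.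
  by rewrite /B => -> /=; rewrite in_itv/= => /andP[].
have := quad_sum_le hE _ hT (B := B) (a := fun i => Num.sqrt (c i)) df.
rewrite big_ord_recr/= /B/= ltnn sqr_sqrtr//.
under eq_bigr => i _ do rewrite ltn_ord sqr_sqrtr//.
apply.
- by apply: continuous_measurable_fun; exact: sqrt_continuous.
- by move=> i; case: ifP => _; exact: measurable_itv.
- move=> i j; rewrite -/(B i) -/(B j).
  wlog ij : i j / (i < j)%N => [W ij|_].
    by case: (ltngtP i j) => [/W|/W|/val_inj/eqP]; rewrite ?(negPf ij)//;
      [apply|rewrite setIC; apply; rewrite eq_sym].
  apply/seteqP; split => x //= -[/B_le x1 /B_gt x2].
  have iM : (i < M)%N by rewrite (leq_trans ij)// -ltnS.
  have := le_lt_trans (x1 iM) (le_lt_trans (cnd _ _ ij) x2).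
  by rewrite ltxx.
- by move=> i; exact: sqrtr_ge0.
- move=> i t; rewrite -/(B i) => /B_gt ct.
  by rewrite ler_wsqrtr// ltW.
Qed.

Lemma level_integral_le f (g l : R)
    (y := fun x => cmod (f x) ^+ 2 / (4 * rip (T f) (T f))) :
  dom T f -> nu f `]-oo, 0]%classic = 0 -> 0 < l ->
  0 < rip (T f) (T f) -> 0 <= g ->
  {ae mu, forall x, cmod (E `]0, l]%classic f x) <= Num.sqrt (g * rip (T f) (T f))} ->
  (\int[mu]_x (y x * (g <= y x)%R%:R)%:E <=
    (nu f `]l, +oo[%classic / rip (T f) (T f))%:E)%E.
Proof.
move=> df nu0 l0; set e := rip (T f) (T f) => e0 g0 ae_le.
have Lf := dom_L2 df; have [mr mi _] := Lf.
have mB : measurable `]0, l]%classic by exact: measurable_itv.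
have mC : measurable `]l, +oo[%classic by exact: measurable_itv.
have LC := E_L2 hE mC Lf.
have split_f : eqae mu f (fun x => E `]0, l]%classic f x + E `]l, +oo[%classic f x).
  apply: E_split => //.
    apply/seteqP; split => x //=; rewrite !in_itv/= => -[/andP[_ x0] /andP[x1 _]].
    by move: x0; rewrite leNgt x1.
  rewrite -itv_bndbnd_setU ?bnd_simp ?(ltW l0)//.
  by rewrite setCitvr.
have my : measurable_fun setT y.
  by apply: measurable_funM => //; apply: measurable_funX; exact: measurable_cmod.
apply: (@le_trans _ _
  (\int[mu]_x ((e^-1)%:E *
    (dot (E `]l, +oo[%classic f) (E `]l, +oo[%classic f) x)%:E))%E).
  apply: ae_ge0_le_integral => //.
  - move=> x _; rewrite lee_fin mulr_ge0// divr_ge0 ?sqr_ge0// mulr_ge0// ltW//.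
  - apply/measurable_EFinP; apply: measurable_funM => //.
    rewrite (_ : (fun x => _) = \1_[set x | (g <= y x)]).
      apply: measurable_indic; rewrite -[X in measurable X]setTI.
      rewrite (_ : [set x | _] = y @^-1` `[g, +oo[%classic); first exact: my.
      by apply/seteqP; split => x /=; rewrite in_itv/= andbT.
    by apply/funext => x; rewrite indicE mem_setE.
  - by move=> x _; rewrite -EFinM lee_fin mulr_ge0 ?invr_ge0 ?dot_ge0// ltW.
  - have [mrC miC _] := LC; apply: measurable_funeM; apply/measurable_EFinP; exact: measurable_dot.
  apply: filterS2 split_f ae_le => x fx Ex _.
  rewrite -EFinM lee_fin /dot -!expr2 -sqr_cmod.
  have e4 : 0 < 4 * e by lra.
  case: (leP g (y x)) => [|_]; last by rewrite mulr0 mulr_ge0 ?sqr_ge0 ?invr_ge0 ?(ltW e0).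
  rewrite mulr1 /y -/e ler_pdivlMr// => gy.
  rewrite invfM mulrA mulrC ler_wpM2l ?invr_ge0 ?(ltW e0)//.
  have half2 : (cmod (f x) / 2) ^+ 2 = cmod (f x) ^+ 2 / 4 by field.
  (* The 4 in y serves here: g <= y x reads (g e)^(1/2) <= |f x| / 2, so the low part takes at most
     half of |f x|. *)
  have : cmod (f x) / 2 <= cmod (E `]l, +oo[%classic f x).
    have := cmod_triangle (E `]0, l]%classic f x) (E `]l, +oo[%classic f x).
    rewrite -fx => tri.
    have : Num.sqrt (g * e) <= cmod (f x) / 2.
      rewrite -[leRHS]ger0_norm ?divr_ge0 ?cmod_ge0// -sqrtr_sqr ler_wsqrtr//.
      by rewrite half2; lra.
    lra.
  have h0 : 0 <= cmod (f x) / 2 by rewrite divr_ge0 ?cmod_ge0.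
  by move=> H; rewrite -half2 ler_pXn2r ?nnegrE ?cmod_ge0.
rewrite ge0_integralZl_EFin//.
- by rewrite -EFin_rip// -nu_sqr// -EFinM mulrC.
- by move=> x _; rewrite lee_fin dot_ge0.
- by have [mrC miC _] := LC; apply/measurable_EFinP; exact: measurable_dot.
- by rewrite invr_ge0 ltW.
Qed.

End energy_bounds.

Theorem theorem1p1 (R : realType) (d : measure_display) (X : measurableType d)
    (mu : {measure set X -> \bar R})
    (A : operator mu) (E : set R -> operator mu) (sqrtA : operator mu) :
  positive_op A -> self_adjoint A ->
  spectral_measure_of A E ->
  sqrt_operator E sqrtA ->
  let F := spectral_density E in
  let G := stieltjes_inv (spectral_density_ge0 E) in
  (forall l : R, 0 < l -> (F l < +oo)%E) ->
  (forall l : R, 0 < l -> (G l < +oo)%E) ->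
  let H (y : R) : \bar R := (y%:E * rc_inverse G y)%E in
  forall f : X -> R[i],
    in_Lp mu 2 f -> ortho_compl mu (ker A) f -> ~ eqae mu f (fun=> 0) ->
    dom sqrtA f ->
    let energy : R := fine (cnorm mu 2 (sqrtA f)) ^+ 2 in
    (\int[mu]_x H ((cmod (f x)) ^+ 2 / (4 * energy))%R <= 1)%E.
Proof.
move=> A_ge0 [A_dense _] [hE hA] hT F G F_fin G_fin H f Lf f_ker _ df; cbv zeta.
rewrite (sqr_cnorm2 (T_L2 df)).
(* For zero energy, division by 0 returns 0 and 0 * oo = 0, so the integrand vanishes
   identically. *)
have [e0|en0] := eqVneq (rip mu (sqrtA f) (sqrtA f)) 0.
  rewrite integral0_eq ?lee01// => x _.
  by rewrite /H e0 mulr0 invr0 mulr0 mul0e.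
have e0 : 0 < rip mu (sqrtA f) (sqrtA f) by rewrite lt0r en0 rip_ge0.
have nu0 := nu_nonpos_ortho_ker hE hA A_ge0 A_dense f_ker.
have [mr mi _] := Lf.
apply: (@integral_rc_inverse_le _ _ _ mu G _ _
  (fun x => cmod (f x) ^+ 2 / (4 * rip mu (sqrtA f) (sqrtA f)))
  (fun l => spectral_mass (E := E) f `]l, +oo[%classic / rip mu (sqrtA f) (sqrtA f))).
- exact: stieltjes_inv_le.
- by apply: stieltjes_inv0; exact: G_fin.
- by apply: measurable_funM => //; apply: measurable_funX; exact: measurable_cmod.
- by move=> x; rewrite divr_ge0 ?sqr_ge0// mulr_ge0// ltW.
- move=> l l0; rewrite /G -(G_fineK G_fin l0).
  under eq_integral do rewrite lee_fin.
  apply: (level_integral_le hE df nu0 l0 e0).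
    by apply: fine_ge0; exact: stieltjes_inv_ge0.
  exact: ae_E_le.
- move=> N M N0; under eq_bigr do rewrite mulrA.
  rewrite -mulr_suml ler_pdivrMr// mul1r; exact: tail_sum_le.
Qed.
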